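(* Let $k$ be a commutative field and $(T,m_T,1_T,\mu_T,\theta_T)$ a $k$-torsor. Then $T$ is a left $H_l(T)$-Galois extension of $k$ (via the coaction $\mu_T:T\to H_l(T)\otimes T$) and a right $H_r(T)$-Galois extension of $k$ (via the coaction $\mu_T:T\to T\otimes H_r(T)$). In particular, in the finite dimensional case, $\dim_k T=\dim_k H_l(T)=\dim_k H_r(T)$.
   Context: All tensor products are over $k$; algebras are unital and associative. $T^{\mathrm{op}}$ is the opposite algebra of $T$. A $k$-torsor is a quintuple $(T,m_T,1_T,\mu_T,\theta_T)$ where $(T,m_T,1_T)$ is a $k$-algebra, $\mu_T:T\to T\otimes T^{\mathrm{op}}\otimes T$ is a $k$-algebra morphism and $\theta_T:T\to T$ is a $k$-algebra automorphism such that: (i) $(\mathrm{Id}_T\otimes m_T)\circ\mu_T(x)=x\otimes 1_T$ for all $x\in T$; (ii) $(m_T\otimes \mathrm{Id}_T)\circ\mu_T(x)=1_T\otimes x$ for all $x\in T$; (iii) $(\mathrm{Id}_T\otimes \mathrm{Id}_{T^{\mathrm{op}}}\otimes\mu_T)\circ\mu_T=(\mu_T\otimes \mathrm{Id}_{T^{\mathrm{op}}}\otimes \mathrm{Id}_T)\circ\mu_T$; (iv) $\theta_T^{(3)}\circ(\mu_T\otimes \mathrm{Id}_{T^{\mathrm{op}}}\otimes \mathrm{Id}_T)\circ\mu_T=(\mathrm{Id}_T\otimes\mu_T^{\mathrm{op}}\otimes \mathrm{Id}_T)\circ\mu_T$; (v) $(\theta_T\otimes\theta_T\otimes\theta_T)\circ\mu_T=\mu_T\circ\theta_T$.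 Here $\mu_T^{\mathrm{op}}:=\tau_{(13)}\circ\mu_T$, where $\tau_{(13)}$ exchanges the first and third tensor factors (regarded as a map $T^{\mathrm{op}}\to T^{\mathrm{op}}\otimes T\otimes T^{\mathrm{op}}$), and $\theta_T^{(3)}:=\mathrm{Id}_T\otimes \mathrm{Id}_{T^{\mathrm{op}}}\otimes\theta_T\otimes \mathrm{Id}_{T^{\mathrm{op}}}\otimes \mathrm{Id}_T$. $H_l(T)$ is the set of $x\in T\otimes T^{\mathrm{op}}$ with $(\mathrm{Id}\otimes \mathrm{Id}\otimes\theta_T\otimes \mathrm{Id})\circ(\mu_T\otimes \mathrm{Id}_{T^{\mathrm{op}}})(x)=(\mathrm{Id}_T\otimes\mu_T^{\mathrm{op}})(x)$. It is a Hopf algebra with the product and unit of $T\otimes T^{\mathrm{op}}$, coproduct $\mu_T\otimes \mathrm{Id}_{T^{\mathrm{op}}}$, and counit given by $m_T(x)=\varepsilon_{H_l(T)}(x)1_T$; $\mu_T$ takes values in $H_l(T)\otimes T$ and makes $T$ a left $H_l(T)$-comodule-algebra. $H_r(T)$ is the set of $x\in T^{\mathrm{op}}\otimes T$ with $(\mathrm{Id}\otimes\theta_T\otimes \mathrm{Id}\otimes \mathrm{Id})\circ(\mathrm{Id}_{T^{\mathrm{op}}}\otimes\mu_T)(x)=(\mu_T^{\mathrm{op}}\otimes \mathrm{Id}_T)(x)$. It is a Hopf algebra with the product and unit of $T^{\mathrm{op}}\otimes T$, coproduct $\mathrm{Id}_{T^{\mathrm{op}}}\otimes\mu_T$, and counit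 given by $m_T(x)=\varepsilon_{H_r(T)}(x)1_T$; $\mu_T$ takes values in $T\otimes H_r(T)$ and makes $T$ a right $H_r(T)$-comodule-algebra. For a Hopf algebra $H$ over $k$, a left $H$-Galois extension $B$ of $k$ is a left $H$-comodule-algebra $B$, with coaction $\Delta_B:B\to H\otimes B$, such that (1) $\{x\in B:\Delta_B(x)=1\otimes x\}=k$ and (2) the map $\mathrm{can}=(\mathrm{Id}_H\otimes m_B)\circ(\Delta_B\otimes \mathrm{Id}_B):B\otimes B\to H\otimes B$ is a linear isomorphism. Right $H$-Galois extensions are defined symmetrically: $B$ is a right $H$-comodule-algebra with coaction $\Delta_B:B\to B\otimes H$, $\{x\in B:\Delta_B(x)=x\otimes 1\}=k$, and $(m_B\otimes \mathrm{Id}_H)\circ(\mathrm{Id}_B\otimes\Delta_B):B\otimes B\to B\otimes H$ is a linear isomorphism. *)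

(* Defs.v *)
From HB Require Import structures.
From mathcomp Require Import all_boot all_algebra generic_quotient.
From mathcomp Require Import boolp classical_sets.

Set Implicit Arguments.
Unset Strict Implicit.
Unset Printing Implicit Defensive.

Import GRing.Theory.
Local Open Scope ring_scope.
Local Open Scope quotient_scope.

Reserved Notation "u ⊗ v" (at level 40, no associativity).

(* Lets [/=] erase the casts inserted around inferred structures. *)
Arguments reverse_coercion {T' T} _ _ /.

(* The tensor product of two vector spaces is the quotient of the set of formal
   sums of pairs (finite sequences) by the congruence generated by the
   bilinearity relations. *)
Section TensorSpace.
Variables (k : fieldType) (U V : algType k).

Inductive tensor_rel : seq (U * V) -> seq (U * V) -> Prop :=
| tensor_rel_refl s : tensor_rel s s
| tensor_rel_sym s t : tensor_rel s t -> tensor_rel t s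
| tensor_rel_trans s t r : tensor_rel s t -> tensor_rel t r -> tensor_rel s r
| tensor_rel_cat s s' t t' :
    tensor_rel s s' -> tensor_rel t t' -> tensor_rel (s ++ t) (s' ++ t')
| tensor_rel_catC s t : tensor_rel (s ++ t) (t ++ s)
| tensor_rel_addl u u' v : tensor_rel [:: (u + u', v)] [:: (u, v); (u', v)]
| tensor_rel_addr u v v' : tensor_rel [:: (u, v + v')] [:: (u, v); (u, v')]
| tensor_rel_scale a u v : tensor_rel [:: (a *: u, v)] [:: (u, a *: v)]
| tensor_rel_0 v : tensor_rel [:: (0, v)] [::].

Definition tensor_relb : rel (seq (U * V)) := fun s t => `[< tensor_rel s t >].

Fact tensor_relb_refl : reflexive tensor_relb.
Proof. by move=> s; apply/asboolP; apply: tensor_rel_refl. Qed.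

Fact tensor_relb_sym : symmetric tensor_relb.
Proof.
by move=> s t; apply/asboolP/asboolP; apply: tensor_rel_sym.
Qed.

Fact tensor_relb_trans : transitive tensor_relb.
Proof.
by move=> t s r /asboolP st /asboolP tr; apply/asboolP/(tensor_rel_trans st tr).
Qed.

Canonical tensor_equiv :=
  EquivRel tensor_relb tensor_relb_refl tensor_relb_sym tensor_relb_trans.

Definition tensor of phant U & phant V := {eq_quot tensor_equiv}.
Local Notation UV := (tensor (Phant U) (Phant V)).

HB.instance Definition _ := Choice.on UV.
HB.instance Definition _ := EqQuotient.on UV.

Definition tclass (s : seq (U * V)) : UV := \pi_UV s.
Definition trepr (x : UV) : seq (U * V) := repr x.

Lemma treprK : cancel trepr tclass.
Proof. by move=> x; rewrite /tclass reprK. Qed.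

Lemma tclassP s t : tclass s = tclass t <-> tensor_rel s t.
Proof.
split=> [/eqP|st]; first by rewrite /tclass eqmodE => /asboolP.
by apply/eqP; rewrite /tclass eqmodE; apply/asboolP.
Qed.

Lemma trepr_rel s : tensor_rel (trepr (tclass s)) s.
Proof. by apply/tclassP; rewrite treprK. Qed.

Let scale_seq (a : k) (s : seq (U * V)) := [seq (a *: p.1, p.2) | p <- s].

Definition tensor_zero : UV := tclass [::].
Definition tensor_add (x y : UV) : UV := tclass (trepr x ++ trepr y).
Definition tensor_scale (a : k) (x : UV) : UV := tclass (scale_seq a (trepr x)).
Definition tensor_opp (x : UV) : UV := tensor_scale (-1) x.
Definition tpure (u : U) (v : V) : UV := tclass [:: (u, v)].

Let addE s t : tensor_add (tclass s) (tclass t) = tclass (s ++ t).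
Proof. by apply/tclassP/tensor_rel_cat; apply: trepr_rel. Qed.

Let scale_rel a s t :
  tensor_rel s t -> tensor_rel (scale_seq a s) (scale_seq a t).
Proof.
elim=> {s t} [s|s t _|s t r _ IH1 _|s s' t t' _ IH1 _ IH2|s t|u u' v|u v v'|b u v|v].
- exact: tensor_rel_refl.
- exact: tensor_rel_sym.
- exact: tensor_rel_trans.
- by rewrite /scale_seq !map_cat; apply: tensor_rel_cat.
- by rewrite /scale_seq !map_cat; apply: tensor_rel_catC.
- by rewrite /= scalerDr; apply: tensor_rel_addl.
- exact: tensor_rel_addr.
- by rewrite /= scalerA mulrC -scalerA; apply: tensor_rel_scale.
- by rewrite /= scaler0; apply: tensor_rel_0.
Qed.

Let scaleE a s : tensor_scale a (tclass s) = tclass (scale_seq a s).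
Proof. by apply/tclassP/scale_rel; apply: trepr_rel. Qed.

Let tensor_seq_ind (P : UV -> Prop) : (forall s, P (tclass s)) -> forall x, P x.
Proof. by move=> Ps x; rewrite -[x]treprK; apply: Ps. Qed.

Fact tensor_addA : associative tensor_add.
Proof.
elim/tensor_seq_ind=> s; elim/tensor_seq_ind=> t; elim/tensor_seq_ind=> r.
by rewrite !addE catA.
Qed.

Fact tensor_addC : commutative tensor_add.
Proof.
elim/tensor_seq_ind=> s; elim/tensor_seq_ind=> t.
by rewrite !addE; apply/tclassP/tensor_rel_catC.
Qed.

Fact tensor_add0 : left_id tensor_zero tensor_add.
Proof. by elim/tensor_seq_ind=> s; rewrite addE. Qed.

Let consE p s : tclass (p :: s) = tensor_add (tpure p.1 p.2) (tclass s).
Proof. by rewrite addE; case: p. Qed.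

Let pure0 v : tpure 0 v = tensor_zero.
Proof. by apply/tclassP/tensor_rel_0. Qed.

Let pureDl u u' v : tpure (u + u') v = tensor_add (tpure u v) (tpure u' v).
Proof. by rewrite addE; apply/tclassP/tensor_rel_addl. Qed.

Let pureDr u v v' : tpure u (v + v') = tensor_add (tpure u v) (tpure u v').
Proof. by rewrite addE; apply/tclassP/tensor_rel_addr. Qed.

Let scale_pure a u v : tensor_scale a (tpure u v) = tpure (a *: u) v.
Proof. by rewrite scaleE. Qed.

Let scaleDr a : {morph tensor_scale a : x y / tensor_add x y}.
Proof.
elim/tensor_seq_ind=> s; elim/tensor_seq_ind=> t.
by rewrite !(addE, scaleE) /scale_seq map_cat.
Qed.

Let scale0 a : tensor_scale a tensor_zero = tensor_zero.
Proof. by rewrite scaleE. Qed.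

Let addACA x y z t : tensor_add (tensor_add x y) (tensor_add z t)
  = tensor_add (tensor_add x z) (tensor_add y t).
Proof.
by rewrite -!tensor_addA; congr tensor_add; rewrite !tensor_addA [tensor_add y z]tensor_addC.
Qed.

Let scaleDl x a b :
  tensor_scale (a + b) x = tensor_add (tensor_scale a x) (tensor_scale b x).
Proof.
elim/tensor_seq_ind: x; elim=> [|p s IH]; first by rewrite !scale0 tensor_add0.
by rewrite consE !scaleDr IH !scale_pure scalerDl pureDl addACA.
Qed.

Fact tensor_addN : left_inverse tensor_zero tensor_opp tensor_add.
Proof.
elim/tensor_seq_ind; elim=> [|p s IH].
  by rewrite /tensor_opp scale0 tensor_add0.
rewrite consE /tensor_opp scaleDr addACA [X in tensor_add _ X]IH.
by rewrite scale_pure -pureDl scaleN1r addNr pure0 tensor_add0.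
Qed.

HB.instance Definition _ := GRing.isZmodule.Build UV
  tensor_addA tensor_addC tensor_add0 tensor_addN.

Fact tensor_scaleA a b x :
  tensor_scale a (tensor_scale b x) = tensor_scale (a * b) x.
Proof.
elim/tensor_seq_ind: x => s; rewrite !scaleE /scale_seq -map_comp.
by congr tclass; apply: eq_map => p /=; rewrite scalerA.
Qed.

Fact tensor_scale1 : left_id 1 tensor_scale.
Proof.
elim/tensor_seq_ind=> s; rewrite scaleE /scale_seq.
by congr tclass; rewrite -[RHS]map_id; apply: eq_map => -[u v]; rewrite /= scale1r.
Qed.

Fact tensor_scaleDl x :
  {morph tensor_scale^~ x : a b / a + b}.
Proof. by move=> a b; apply: scaleDl. Qed.

HB.instance Definition _ := GRing.Zmodule_isLmodule.Build k UV
  tensor_scaleA tensor_scale1 scaleDr tensor_scaleDl.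

Lemma tpureDl u u' v : tpure (u + u') v = tpure u v + tpure u' v.
Proof. exact: pureDl. Qed.
Lemma tpureDr u v v' : tpure u (v + v') = tpure u v + tpure u v'.
Proof. exact: pureDr. Qed.
Lemma tpureZl a u v : tpure (a *: u) v = a *: tpure u v.
Proof. exact/esym/scale_pure. Qed.
Lemma tpureZr a u v : tpure u (a *: v) = a *: tpure u v.
Proof.
rewrite -tpureZl; apply/esym/tclassP.
exact: tensor_rel_scale.
Qed.

Lemma tensor_ind (P : UV -> Prop) :
  P 0 -> (forall u v x, P x -> P (tpure u v + x)) -> forall x, P x.
Proof.
move=> P0 PD; elim/tensor_seq_ind; elim=> [|p s IH]; first exact: P0.
by rewrite consE; apply: PD.
Qed.

Section Lift.
Variables (W : lmodType k) (f : U -> V -> W).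

Definition bilinear_fun : Prop :=
  (forall v, linear (f^~ v)) /\ (forall u, linear (f u)).

Definition tlift (x : UV) : W := \sum_(p <- trepr x) f p.1 p.2.

Hypothesis f_bil : bilinear_fun.

Let fDl u u' v : f (u + u') v = f u v + f u' v.
Proof. by have := f_bil.1 v 1 u u'; rewrite /= !scale1r. Qed.
Let fDr u v v' : f u (v + v') = f u v + f u v'.
Proof. by have := f_bil.2 u 1 v v'; rewrite /= !scale1r. Qed.
Let f0l v : f 0 v = 0.
Proof. by apply: (addrI (f 0 v)); rewrite -fDl !addr0. Qed.
Let f0r u : f u 0 = 0.
Proof. by apply: (addrI (f u 0)); rewrite -fDr !addr0. Qed.
Let fZl a u v : f (a *: u) v = a *: f u v.
Proof. by have := f_bil.1 v a u 0; rewrite /= f0l !addr0. Qed.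
Let fZr a u v : f u (a *: v) = a *: f u v.
Proof. by have := f_bil.2 u a v 0; rewrite /= f0r !addr0. Qed.

Let lift_rel s t :
  tensor_rel s t -> \sum_(p <- s) f p.1 p.2 = \sum_(p <- t) f p.1 p.2.
Proof.
elim=> {s t}
  [s|s t _|s t r _ IH1 _|s s' t t' _ IH1 _ IH2|s t|u u' v|u v v'|b u v|v] //.
- by rewrite IH1.
- by rewrite !big_cat IH1 IH2.
- by rewrite !big_cat /= addrC.
- by rewrite !(big_cons, big_nil) fDl !addr0.
- by rewrite !(big_cons, big_nil) fDr !addr0.
- by rewrite !(big_cons, big_nil) fZl fZr.
- by rewrite !(big_cons, big_nil) f0l addr0.
Qed.

Let tliftE s : tlift (tclass s) = \sum_(p <- s) f p.1 p.2.
Proof. exact/lift_rel/trepr_rel. Qed.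

Lemma tlift_pure u v : tlift (tpure u v) = f u v.
Proof. by rewrite tliftE big_cons big_nil addr0. Qed.

Lemma tlift_linear : linear tlift.
Proof.
move=> a; elim/tensor_seq_ind=> s; elim/tensor_seq_ind=> t.
rewrite -[a *: _]/(tensor_scale a _) -[_ + _]/(tensor_add _ _) scaleE addE.
rewrite !tliftE big_cat big_map scaler_sumr; congr (_ + _).
by apply: eq_bigr => p _; rewrite fZl.
Qed.

Lemma tlift0 : tlift 0 = 0.
Proof. by rewrite [LHS]tliftE big_nil. Qed.

Lemma tliftD x y : tlift (x + y) = tlift x + tlift y.
Proof. by have := tlift_linear 1 x y; rewrite !scale1r. Qed.

End Lift.

Lemma tensor_linear_eq (W : lmodType k) (f g : {linear UV -> W}) :
  (forall u v, f (tpure u v) = g (tpure u v)) -> f =1 g.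
Proof.
move=> fg; elim/tensor_ind=> [|u v x IH]; first by rewrite !linear0.
by rewrite !linearD IH fg.
Qed.

End TensorSpace.

Notation "U ⊗ V" := (tensor (Phant U%type) (Phant V%type)) : type_scope.
Notation "u ⊗ v" := (tpure u v) : ring_scope.

Section TensorMap.
Variables (k : fieldType).

Lemma tpure_bilinear (U V : algType k) : bilinear_fun (@tpure k U V).
Proof.
by split=> [v|u] a x y; rewrite ?tpureDl ?tpureDr ?tpureZl ?tpureZr.
Qed.

Section Map.
Variables (U V U' V' : algType k).
Variables (f : {linear U -> U'}) (g : {linear V -> V'}).

Definition tmap : U ⊗ V -> U' ⊗ V' := tlift (fun u v => f u ⊗ g v).

Fact tmap_bilinear : bilinear_fun (fun u v => f u ⊗ g v).
Proof.
by split=> [v|u] a x y; rewrite linearP ?tpureDl ?tpureDr ?tpureZl ?tpureZr.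
Qed.

HB.instance Definition _ :=
  GRing.isLinear.Build k _ _ _ tmap (tlift_linear tmap_bilinear).

Lemma tmapE u v : tmap (u ⊗ v) = f u ⊗ g v.
Proof. exact: (tlift_pure tmap_bilinear). Qed.

End Map.

End TensorMap.

Section Functional.
Variables (k : fieldType) (U : lmodType k).
Local Open Scope classical_set_scope.

Lemma exists_functional (u : U) : u != 0 -> exists f : {scalar U}, f u = 1.
Proof.
move=> u0.
pose P (M : set U) := ~ M u /\ forall a x y, M x -> M y -> M (a *: x + y).
have /Zorn_bigcup[M [[Mu Mlin] Mmax]] : forall F : set (set U), F `<=` P ->
    total_on F subset -> P (\bigcup_(X in F) X).
  move=> F FP Ftot; split=> [[X FX]|a x y [X FX Xx] [Y FY Yy]].
    by have [] := FP _ FX.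
  by have [XY|YX] := Ftot _ _ FX FY; [exists Y|exists X] => //;
    apply: (FP _ _).2 => //; [exact: XY|exact: YX].
have M0 : M 0.
  apply: contrapT => nM0; apply: (Mmax (M `|` [set 0])).
    by split=> [x|sub]; [left | apply/nM0/sub; right].
  have nM x : ~ M x.
    by move=> Mx; apply: nM0; have := Mlin (-1) x x Mx Mx; rewrite scaleN1r addNr.
  split=> [[//|/eqP]|a x y]; first by rewrite (negPf u0).
  by move=> [/nM//|->] [/nM//|->]; right; rewrite scaler0 addr0.
have MZ a x : M x -> M (a *: x) by move=> Mx; rewrite -[_ *: _]addr0; apply: Mlin.
have decomp x : exists a, M (x - a *: u).
  apply: contrapT => nx.
  pose N := [set y | exists2 m, M m & exists c, y = m + c *: x].
  have xN : N x by exists 0 => //; exists 1; rewrite add0r scale1r.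
  apply: (Mmax N).
    split=> [m Mm|NM]; first by exists m => //; exists 0; rewrite scale0r addr0.
    by apply: nx; exists 0; rewrite scale0r subr0; apply: NM.
  split=> [[m Mm [c uE]]|a _ _ [m Mm [c ->]] [m' Mm' [c' ->]]]; last first.
    exists (a *: m + m'); first exact: Mlin.
    by exists (a * c + c'); rewrite scalerDr scalerA scalerDl addrACA.
  have c0 : c != 0 by apply/eqP => c0; apply: Mu; rewrite uE c0 scale0r addr0.
  apply: nx; exists c^-1; rewrite uE scalerDr scalerA mulVf// scale1r.
  by rewrite opprD addrCA subrr addr0 -scaleNr; apply: MZ.
pose f x := xget 0 [set a | M (x - a *: u)].
have fP x : M (x - f x *: u).
  by rewrite /f; case: xgetP => [a _ //|no]; have [a /no] := decomp x.
have funiq x a : M (x - a *: u) -> f x = a.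
  move=> Ma; apply/eqP; rewrite -subr_eq0; apply/negP => /negP d0; apply: Mu.
  have := MZ (f x - a)^-1 _ (Mlin (-1) _ _ (fP x) Ma).
  rewrite scaleN1r opprB addrA subrK -scalerBl scalerA mulVf//.
  by rewrite scale1r.
have f_lin : scalar f.
  move=> a x y; apply: funiq; rewrite scalerDl -scalerA opprD addrACA -scalerBr.
  exact: Mlin (fP x) (fP y).
pose fM := GRing.isLinear.Build k U k _ f f_lin.
exists (HB.pack_for {scalar U} f fM) => /=.
by apply: funiq; rewrite scale1r subrr.
Qed.

End Functional.

Section PureNonzero.
Variables (k : fieldType) (U V : algType k).

Lemma tpure_neq0 (u : U) (v : V) : u != 0 -> v != 0 -> u ⊗ v != 0.
Proof.
move=> /exists_functional[f fu] /exists_functional[g gv].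
have fg_bil : bilinear_fun (fun u v => f u * g v : k^o).
  split=> [y|x] a x1 x2; first by rewrite linearP mulrDl -mulrA.
  by rewrite linearP mulrDr mulrCA.
apply/eqP => uv0; have /eqP := tlift_pure fg_bil u v.
by rewrite uv0 fu gv mulr1 (tlift0 fg_bil) eq_sym oner_eq0.
Qed.

End PureNonzero.

Section TensorAlgebra.
Variables (k : fieldType) (A B : algType k).

Definition lmul (C : algType k) (c : C) : C -> C := fun x => c * x.

Fact lmul_linear (C : algType k) (c : C) : linear (lmul c).
Proof. by move=> a x y; rewrite /lmul mulrDr scalerAr. Qed.

HB.instance Definition _ (C : algType k) (c : C) :=
  GRing.isLinear.Build k C C _ (lmul c) (lmul_linear c).

Definition tensor_mul (x y : A ⊗ B) : A ⊗ B :=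
  tlift (fun a b => tmap (lmul a) (lmul b) y) x.

Fact tensor_mul_bilinear y :
  bilinear_fun (fun (a : A) (b : B) => tmap (lmul a) (lmul b) y).
Proof.
split=> [b|a] c x x'; elim/tensor_ind: y => [|a' b' y IH];
  rewrite /= ?linear0 ?addr0 // !linearD /= IH !tmapE /= /lmul.
  by rewrite mulrDl -scalerAl tpureDl tpureZl addrACA.
by rewrite mulrDl -scalerAl tpureDr tpureZr addrACA.
Qed.

Lemma tensor_mulE a b a' b' :
  tensor_mul (a ⊗ b) (a' ⊗ b') = (a * a') ⊗ (b * b').
Proof. by rewrite /tensor_mul (tlift_pure (tensor_mul_bilinear _)) tmapE. Qed.

Fact tensor_mul_linearl y : linear (tensor_mul^~ y).
Proof. exact: tlift_linear (tensor_mul_bilinear y). Qed.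

Fact tensor_mul0l y : tensor_mul 0 y = 0.
Proof. exact: tlift0 (tensor_mul_bilinear y). Qed.

Fact tensor_mulDl : left_distributive tensor_mul +%R.
Proof. by move=> x x' y; apply: tliftD (tensor_mul_bilinear y) _ _. Qed.

Fact tensor_mul_pure a b y : tensor_mul (a ⊗ b) y = tmap (lmul a) (lmul b) y.
Proof. exact: tlift_pure (tensor_mul_bilinear y) _ _. Qed.

Fact tensor_mul_linearr x : linear (tensor_mul x).
Proof.
move=> c y y'; elim/tensor_ind: x => [|a b x IH].
  by rewrite !tensor_mul0l scaler0 addr0.
by rewrite !tensor_mulDl IH !tensor_mul_pure linearP scalerDr addrACA.
Qed.

Fact tensor_mul0r x : tensor_mul x 0 = 0.
Proof.
by have := tensor_mul_linearr x (-1) 0 0; rewrite scaler0 addr0 scaleN1r addNr.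
Qed.

Fact tensor_mulDr : right_distributive tensor_mul +%R.
Proof. by move=> x y z; have := tensor_mul_linearr x 1 y z; rewrite !scale1r. Qed.

Fact tensor_mulA : associative tensor_mul.
Proof.
move=> x y z; elim/tensor_ind: x => [|a b x IHx].
  by rewrite !tensor_mul0l.
rewrite !tensor_mulDl IHx; congr (_ + _).
elim/tensor_ind: y {IHx} => [|a' b' y IHy].
  by rewrite !(tensor_mul0l, tensor_mul0r).
rewrite !(tensor_mulDl, tensor_mulDr) IHy; congr (_ + _).
elim/tensor_ind: z {IHy} => [|a'' b'' z IHz].
  by rewrite !(tensor_mul0l, tensor_mul0r).
by rewrite !tensor_mulDr IHz !tensor_mulE !mulrA.
Qed.

Fact tensor_mul1l : left_id (1 ⊗ 1) tensor_mul.
Proof.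
elim/tensor_ind=> [|a b x IH]; first exact: tensor_mul0r.
by rewrite tensor_mulDr IH tensor_mulE !mul1r.
Qed.

Fact tensor_mul1r : right_id (1 ⊗ 1) tensor_mul.
Proof.
elim/tensor_ind=> [|a b x IH]; first exact: tensor_mul0l.
by rewrite tensor_mulDl IH tensor_mulE !mulr1.
Qed.

Fact tensor_one_neq0 : (1 : A) ⊗ (1 : B) != 0.
Proof. by apply: tpure_neq0; apply: oner_neq0. Qed.

HB.instance Definition _ := GRing.Zmodule_isNzRing.Build (A ⊗ B)%type
  tensor_mulA tensor_mul1l tensor_mul1r tensor_mulDl tensor_mulDr tensor_one_neq0.

Lemma tmulE (a a' : A) (b b' : B) :
  (a ⊗ b) * (a' ⊗ b') = (a * a') ⊗ (b * b').
Proof. exact: tensor_mulE. Qed.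

Lemma toneE : (1 : A ⊗ B) = 1 ⊗ 1. Proof. by []. Qed.

Fact tensor_scaleAl c (x y : A ⊗ B) : c *: (x * y) = (c *: x) * y.
Proof.
by have := tensor_mul_linearl y c x 0; rewrite tensor_mul0l !addr0.
Qed.

Fact tensor_scaleAr c (x y : A ⊗ B) : c *: (x * y) = x * (c *: y).
Proof.
by have := tensor_mul_linearr x c y 0; rewrite tensor_mul0r !addr0.
Qed.

HB.instance Definition _ := GRing.Lmodule_isLalgebra.Build k (A ⊗ B)%type
  tensor_scaleAl.
HB.instance Definition _ := GRing.Lalgebra_isAlgebra.Build k (A ⊗ B)%type
  tensor_scaleAr.

End TensorAlgebra.

Section TensorIsomorphisms.
Variable k : fieldType.

Section Swap.
Variables U V : algType k.

Definition tswap : U ⊗ V -> V ⊗ U := tlift (fun u v => v ⊗ u).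

Fact tswap_bilinear : bilinear_fun (fun (u : U) (v : V) => v ⊗ u).
Proof.
by split=> [v|u] a x y; rewrite ?tpureDl ?tpureDr ?tpureZl ?tpureZr.
Qed.

HB.instance Definition _ :=
  GRing.isLinear.Build k _ _ _ tswap (tlift_linear tswap_bilinear).

Lemma tswapE u v : tswap (u ⊗ v) = v ⊗ u.
Proof. exact: (tlift_pure tswap_bilinear). Qed.
End Swap.

Section Assoc.
Variables U V W : algType k.

Definition tpurel (u : U) : V -> U ⊗ V := fun v => u ⊗ v.
Definition tpurer (v : V) : U -> U ⊗ V := fun u => u ⊗ v.
HB.instance Definition _ u := GRing.isLinear.Build k _ _ _ (tpurel u)
  ((@tpure_bilinear _ U V).2 u).
HB.instance Definition _ v := GRing.isLinear.Build k _ _ _ (tpurer v)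
  ((@tpure_bilinear _ U V).1 v).

End Assoc.

Section Assoc2.
Variables U V W : algType k.

Definition tassoc : (U ⊗ V) ⊗ W -> U ⊗ (V ⊗ W) :=
  tlift (fun x w => tmap idfun (@tpurer V W w) x).

Fact tassoc_bilinear :
  bilinear_fun (fun (x : U ⊗ V) (w : W) => tmap idfun (@tpurer V W w) x).
Proof.
split=> [w|x] a; first exact: linearP.
move=> w w'; elim/tensor_ind: x => [|u v x IH]; first by rewrite !linear0 addr0.
rewrite /= !linearD /= IH !tmapE /= /tpurer tpureDr tpureZr tpureDr tpureZr.
by rewrite addrACA.
Qed.

HB.instance Definition _ := GRing.isLinear.Build k _ _ _ tassoc (tlift_linear tassoc_bilinear).

Lemma tassocE u v w : tassoc ((u ⊗ v) ⊗ w) = u ⊗ (v ⊗ w).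
Proof. by rewrite /tassoc (tlift_pure tassoc_bilinear) tmapE. Qed.

Definition tassocV : U ⊗ (V ⊗ W) -> (U ⊗ V) ⊗ W :=
  tlift (fun u x => tmap (@tpurel U V u) idfun x).

Fact tassocV_bilinear :
  bilinear_fun (fun (u : U) (x : V ⊗ W) => tmap (@tpurel U V u) idfun x).
Proof.
split=> [x|u] a; last exact: linearP.
move=> u u'; elim/tensor_ind: x => [|v w x IH]; first by rewrite !linear0 addr0.
rewrite /= !linearD /= IH !tmapE /= /tpurel tpureDl tpureZl tpureDl tpureZl.
by rewrite addrACA.
Qed.

HB.instance Definition _ := GRing.isLinear.Build k _ _ _ tassocV (tlift_linear tassocV_bilinear).

Lemma tassocVE u v w : tassocV (u ⊗ (v ⊗ w)) = (u ⊗ v) ⊗ w.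
Proof. by rewrite /tassocV (tlift_pure tassocV_bilinear) tmapE. Qed.

End Assoc2.

Section Assoc3.
Variables U V W X : algType k.

Definition tassoc3 : (U ⊗ (V ⊗ W)) ⊗ X -> U ⊗ (V ⊗ (W ⊗ X)) :=
  tmap idfun (@tassoc V W X) \o @tassoc _ _ _.
HB.instance Definition _ := GRing.Linear.on tassoc3.

Lemma tassoc3E u v w x : tassoc3 ((u ⊗ (v ⊗ w)) ⊗ x) = u ⊗ (v ⊗ (w ⊗ x)).
Proof. by rewrite /tassoc3 /= tassocE tmapE /= tassocE. Qed.

End Assoc3.

Section Flip.
Variables U V W : algType k.
Definition tflip13 : U ⊗ (V ⊗ W) -> W ⊗ (V ⊗ U) :=
  @tassoc W V U \o tmap (@tswap V W) idfun \o @tswap _ _.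
HB.instance Definition _ := GRing.Linear.on tflip13.
Lemma tflip13E u v w : tflip13 (u ⊗ (v ⊗ w)) = w ⊗ (v ⊗ u).
Proof. by rewrite /tflip13 /= tswapE tmapE /= tswapE tassocE. Qed.
End Flip.

End TensorIsomorphisms.

HB.instance Definition _ (k : pzRingType) (V : lmodType k) :=
  GRing.Lmodule.on V^c.

Section OppositeAlgebra.
Variables (k : pzRingType) (A : algType k).

Fact converse_scaleAl (a : k) (x y : A^c) : a *: (x * y) = (a *: x : A^c) * y.
Proof. exact: (@scalerAr k A a y x). Qed.

Fact converse_scaleAr (a : k) (x y : A^c) : a *: (x * y) = x * (a *: y : A^c).
Proof. exact: (@scalerAl k A a y x). Qed.

HB.instance Definition _ := GRing.Lmodule_isLalgebra.Build k A^c converse_scaleAl.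
HB.instance Definition _ := GRing.Lalgebra_isAlgebra.Build k A^c converse_scaleAr.

Definition to_op_fun : A -> A^c := fun x => x.
Definition of_op_fun : A^c -> A := fun x => x.

Fact to_op_linear : linear to_op_fun. Proof. by []. Qed.
Fact of_op_linear : linear of_op_fun. Proof. by []. Qed.

HB.instance Definition _ := GRing.isLinear.Build k _ _ _ to_op_fun to_op_linear.
HB.instance Definition _ := GRing.isLinear.Build k _ _ _ of_op_fun of_op_linear.

Definition to_op := GRing.Linear.clone _ _ _ _ to_op_fun _.
Definition of_op := GRing.Linear.clone _ _ _ _ of_op_fun _.

Lemma to_opM x y : to_op (x * y) = to_op y * to_op x. Proof. by []. Qed.
Lemma of_opM x y : of_op (x * y) = of_op y * of_op x. Proof. by []. Qed.

End OppositeAlgebra.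


Section MultiplicationMap.
Variables (k : fieldType) (A : algType k).

Fact mul_bilinear : bilinear_fun (fun x y : A => x * y).
Proof.
split=> [y|x] a u v; first by rewrite mulrDl scalerAl.
by rewrite mulrDr scalerAr.
Qed.

Definition tmul : A ⊗ A -> A := tlift (fun x y => x * y).

HB.instance Definition _ := GRing.isLinear.Build k _ _ _ tmul
  (tlift_linear mul_bilinear).

Lemma tmul_pure x y : tmul (x ⊗ y) = x * y.
Proof. exact: (tlift_pure mul_bilinear). Qed.

End MultiplicationMap.

Section TensorInduction.
Variables (k : fieldType) (U V W : algType k).

Lemma tpure0l (v : V) : (0 : U) ⊗ v = 0.
Proof. by rewrite -(scale0r 0) tpureZl scale0r. Qed.

Lemma tpure0r (u : U) : u ⊗ (0 : V) = 0.
Proof. by rewrite -(scale0r 0) tpureZr scale0r. Qed.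

Lemma tensor_ind3 (P : U ⊗ (V ⊗ W) -> Prop) :
  P 0 -> (forall u v w x, P x -> P (u ⊗ (v ⊗ w) + x)) -> forall x, P x.
Proof.
move=> P0 PD; elim/tensor_ind=> // u y x; elim/tensor_ind: y x => [|v w y IH] x Px.
  by rewrite -(scale0r 0) tpureZr scale0r add0r.
by rewrite tpureDr -addrA; apply/PD/IH.
Qed.

Lemma tensor_ind3' (P : (U ⊗ V) ⊗ W -> Prop) :
  P 0 -> (forall u v w x, P x -> P ((u ⊗ v) ⊗ w + x)) -> forall x, P x.
Proof.
move=> P0 PD; elim/tensor_ind=> // y w x; elim/tensor_ind: y x => [|u v y IH] x Px.
  by rewrite -(scale0r 0) tpureZl scale0r add0r.
by rewrite tpureDl -addrA; apply/PD/IH.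
Qed.

End TensorInduction.

Section AlgebraMorphisms.
Variables (k : fieldType).

Lemma idfun_monoid (A : algType k) : monoid_morphism (@idfun A).
Proof. by []. Qed.

Lemma comp_monoid (A B C : algType k) (f : B -> C) (g : A -> B) :
  monoid_morphism f -> monoid_morphism g -> monoid_morphism (f \o g).
Proof. by move=> [f1 fM] [g1 gM]; split=> [|x y] /=; rewrite ?g1 ?gM. Qed.

Lemma lrmorphism_monoid (A B : algType k) (f : {lrmorphism A -> B}) :
  monoid_morphism f.
Proof. by split; [apply: rmorph1 | apply: rmorphM]. Qed.

Lemma tmap_monoid (A B A' B' : algType k)
    (f : {linear A -> A'}) (g : {linear B -> B'}) :
  monoid_morphism f -> monoid_morphism g -> monoid_morphism (tmap f g).
Proof.
move=> [f1 fM] [g1 gM]; split=> [|x y]; first by rewrite !toneE tmapE f1 g1.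
elim/tensor_ind: x => [|a b x IHx]; first by rewrite !(mul0r, linear0).
rewrite mulrDl !linearD /= mulrDl IHx; congr (_ + _).
elim/tensor_ind: y {IHx} => [|a' b' y IHy]; first by rewrite !(mulr0, linear0).
by rewrite mulrDr !linearD /= mulrDr IHy !(tmulE, tmapE) fM gM.
Qed.

Lemma tassoc_monoid (A B C : algType k) : monoid_morphism (@tassoc k A B C).
Proof.
split=> [|x y]; first by rewrite !toneE tassocE.
elim/tensor_ind3': x => [|a b c x IHx]; first by rewrite !(mul0r, linear0).
rewrite mulrDl !linearD /= mulrDl IHx; congr (_ + _).
elim/tensor_ind3': y {IHx} => [|a' b' c' y IHy]; first by rewrite !(mulr0, linear0).
by rewrite mulrDr !linearD /= mulrDr IHy !(tmulE, tassocE).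
Qed.

Lemma tassoc3_monoid (A B C D : algType k) : monoid_morphism (@tassoc3 k A B C D).
Proof.
have [a1 aM] := tassoc_monoid B C D; have [b1 bM] := @tassoc_monoid A (B ⊗ C)%type D.
have [c1 cM] := @tmap_monoid _ _ _ _ idfun _ (@idfun_monoid A)
  (tassoc_monoid B C D).
by split=> [|x y]; rewrite /tassoc3 /= ?b1 ?bM ?c1 ?cM.
Qed.

End AlgebraMorphisms.

Section TorsorMaps.
Variables (k : fieldType) (T : algType k).

(* The permutation tau_(13), read as a map between opposite algebras. *)
Definition tau13 : T ⊗ (T^c ⊗ T) -> T^c ⊗ (T ⊗ T^c) :=
  tmap (to_op T) (tmap (of_op T) (to_op T)) \o @tflip13 _ _ _ _.
HB.instance Definition _ := GRing.Linear.on tau13.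

Lemma tau13E (x z : T) (y : T^c) : tau13 (x ⊗ (y ⊗ z)) = to_op T z ⊗ (of_op T y ⊗ to_op T x).
Proof. by rewrite /tau13 /= tflip13E tmapE /= tmapE. Qed.

Lemma tau13_antimorphism : (tau13 1 = 1) * {morph tau13 : x y / x * y >-> y * x}.
Proof.
split=> [|x y]; first by rewrite !toneE tau13E.
elim/tensor_ind3: x => [|a b c x IHx]; first by rewrite !(mul0r, mulr0, linear0).
rewrite mulrDl !linearD /= mulrDr IHx; congr (_ + _).
elim/tensor_ind3: y {IHx} => [|a' b' c' y IHy].
  by rewrite !(mulr0, mul0r, linear0).
by rewrite mulrDr !linearD /= mulrDl IHy !(tmulE, tau13E).
Qed.

Definition mul_op_l : T^c ⊗ T -> T := @tmul k T \o tmap (of_op T) idfun.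
Definition mul_op_r : T ⊗ T^c -> T := @tmul k T \o tmap idfun (of_op T).
HB.instance Definition _ := GRing.Linear.on mul_op_l.
HB.instance Definition _ := GRing.Linear.on mul_op_r.

Variables (mu : {lrmorphism T -> T ⊗ (T^c ⊗ T)}) (theta : {lrmorphism T -> T}).

Definition mu_op : T^c -> T^c ⊗ (T ⊗ T^c) := tau13 \o mu \o of_op T.
HB.instance Definition _ := GRing.Linear.on mu_op.

Definition theta_op : T^c -> T^c := to_op T \o theta \o of_op T.
HB.instance Definition _ := GRing.Linear.on theta_op.

Record is_torsor : Prop := IsTorsor {
  theta_bij : bijective theta;
  mu_mulr : forall x, tmap idfun mul_op_l (mu x) = x ⊗ 1;
  mu_mull : forall x, tmap mul_op_r idfun (tassocV (mu x)) = 1 ⊗ x;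
  mu_coassoc : forall x,
    tmap idfun (tmap idfun mu) (mu x) = tassoc3 (tmap mu idfun (mu x));
  mu_theta3 : forall x,
    tmap idfun (tmap idfun (tmap theta idfun)) (tassoc3 (tmap mu idfun (mu x)))
    = tmap idfun (@tassoc3 _ _ _ _ _ \o tmap mu_op idfun) (mu x);
  mu_theta : forall x, tmap theta (tmap theta_op theta) (mu x) = mu (theta x)
}.

End TorsorMaps.

Record torsor (k : fieldType) := Torsor {
  torsor_alg :> algType k;
  mu : {lrmorphism torsor_alg -> torsor_alg ⊗ (torsor_alg^c ⊗ torsor_alg)};
  theta : {lrmorphism torsor_alg -> torsor_alg};
  torsorP : is_torsor mu theta
}.

Section EqualizerSubalgebra.
Variables (k : fieldType) (A B : algType k) (f g : {linear A -> B}).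

Lemma equalizer_subalg_closed : monoid_morphism f -> monoid_morphism g ->
  subalg_closed (fun x => f x == g x).
Proof.
move=> [f1 fM] [g1 gM]; split; rewrite ?unfold_in ?f1 ?g1 //.
  by move=> a x y; rewrite !unfold_in !linearP => /eqP-> /eqP->.
by move=> x y; rewrite !unfold_in fM gM => /eqP-> /eqP->.
Qed.

End EqualizerSubalgebra.

Section HopfAlgebrasOfTorsor.
Variables (k : fieldType) (T : torsor k).
Local Notation mu := (mu T).
Local Notation mu_op := (mu_op mu).
Local Notation theta := (theta T).

Lemma mu_op_monoid : monoid_morphism mu_op.
Proof.
have [t1 tM] := tau13_antimorphism T.
have m1 : mu 1 = 1 := rmorph1 mu.
have mM (x y : T) : mu (x * y) = mu x * mu y := rmorphM mu x y.
split=> [|x y]; first by rewrite -t1 -m1.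
by rewrite -[LHS]/(tau13 (mu (of_op T y * of_op T x))) mM tM.
Qed.

Definition mu_id (x : T ⊗ T^c) : T ⊗ (T^c ⊗ (T ⊗ T^c)) :=
  tassoc3 (tmap mu idfun x).

Definition id_mu (x : T^c ⊗ T) : T^c ⊗ (T ⊗ (T^c ⊗ T)) := tmap idfun mu x.

Definition in_Hl (x : T ⊗ T^c) : bool :=
  tmap idfun (tmap idfun (tmap theta idfun)) (mu_id x) == tmap idfun mu_op x.

Definition in_Hr (x : T^c ⊗ T) : bool :=
  tmap idfun (tmap theta idfun) (id_mu x) == tassoc3 (tmap mu_op idfun x).

Fact in_Hl_subalg : subalg_closed in_Hl.
Proof.
pose f : T ⊗ T^c -> T ⊗ (T^c ⊗ (T ⊗ T^c)) :=
  tmap idfun (tmap idfun (tmap theta idfun)) \o (@tassoc3 _ _ _ _ _ \o tmap mu idfun).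
apply: (@equalizer_subalg_closed _ _ _ f (tmap idfun mu_op)).
  apply: comp_monoid; last apply: comp_monoid.
  - apply/tmap_monoid/tmap_monoid/tmap_monoid; try exact: idfun_monoid.
    exact: lrmorphism_monoid.
  - exact: tassoc3_monoid.
  - apply: tmap_monoid; last exact: idfun_monoid.
    exact: lrmorphism_monoid.
by apply: tmap_monoid; [exact: idfun_monoid | exact: mu_op_monoid].
Qed.

Fact in_Hr_subalg : subalg_closed in_Hr.
Proof.
pose f : T^c ⊗ T -> T^c ⊗ (T ⊗ (T^c ⊗ T)) :=
  tmap idfun (tmap theta idfun) \o tmap idfun mu.
pose g : T^c ⊗ T -> T^c ⊗ (T ⊗ (T^c ⊗ T)) :=
  @tassoc3 _ _ _ _ _ \o tmap mu_op idfun.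
apply: (@equalizer_subalg_closed _ _ _ f g); apply: comp_monoid.
- apply/tmap_monoid/tmap_monoid; try exact: idfun_monoid.
  exact: lrmorphism_monoid.
- apply: tmap_monoid; first exact: idfun_monoid.
  exact: lrmorphism_monoid.
- exact: tassoc3_monoid.
- by apply: tmap_monoid; [exact: mu_op_monoid | exact: idfun_monoid].
Qed.

HB.instance Definition _ := GRing.isSubalgClosed.Build k _ in_Hl in_Hl_subalg.
HB.instance Definition _ := GRing.isSubalgClosed.Build k _ in_Hr in_Hr_subalg.

Record Hl : Type := MkHl { Hl_val : T ⊗ T^c; Hl_valP : in_Hl Hl_val }.
Record Hr : Type := MkHr { Hr_val : T^c ⊗ T; Hr_valP : in_Hr Hr_val }.

HB.instance Definition _ := [isSub for Hl_val].
HB.instance Definition _ := [Choice of Hl by <:].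
HB.instance Definition _ := [SubChoice_isSubAlgebra of Hl by <:].
HB.instance Definition _ := [isSub for Hr_val].
HB.instance Definition _ := [Choice of Hr by <:].
HB.instance Definition _ := [SubChoice_isSubAlgebra of Hr by <:].

End HopfAlgebrasOfTorsor.

Section GaloisExtensions.
Variable k : fieldType.

Record hopf_algebra (H : algType k) := HopfAlgebra {
  comul : {lrmorphism H -> H ⊗ H};
  counit : {lrmorphism H -> k^o};
  antipode : {linear H -> H};
  comul_coassoc : forall h,
    tassoc (tmap comul idfun (comul h)) = tmap idfun comul (comul h);
  comul_counitl : forall h, tmap counit idfun (comul h) = 1 ⊗ h;
  comul_counitr : forall h, tmap idfun counit (comul h) = h ⊗ 1;
  antipodel : forall h, tmul (tmap antipode idfun (comul h)) = (counit h)%:A;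
  antipoder : forall h, tmul (tmap idfun antipode (comul h)) = (counit h)%:A
}.

Section Left.
Variables (H : algType k) (hH : hopf_algebra H).
Variables (B : algType k) (delta : {lrmorphism B -> H ⊗ B}).

Record left_comodule_algebra : Prop := LeftComoduleAlgebra {
  lcoaction_coassoc : forall b,
    tassoc (tmap (comul hH) idfun (delta b)) = tmap idfun delta (delta b);
  lcoaction_counit : forall b, tmap (counit hH) idfun (delta b) = 1 ⊗ b
}.

Definition left_can (x : B ⊗ B) : H ⊗ B :=
  tmap idfun (@tmul k B) (tassoc (tmap delta idfun x)).

Record left_galois_extension : Prop := LeftGaloisExtension {
  left_galois_comodule : left_comodule_algebra;
  left_galois_coinv : forall b, delta b = 1 ⊗ b <-> exists c : k, b = c%:A;
  left_galois_can : bijective left_can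
}.

End Left.

Section Right.
Variables (H : algType k) (hH : hopf_algebra H).
Variables (B : algType k) (delta : {lrmorphism B -> B ⊗ H}).

Record right_comodule_algebra : Prop := RightComoduleAlgebra {
  rcoaction_coassoc : forall b,
    tassoc (tmap delta idfun (delta b)) = tmap idfun (comul hH) (delta b);
  rcoaction_counit : forall b, tmap idfun (counit hH) (delta b) = b ⊗ 1
}.

Definition right_can (x : B ⊗ B) : B ⊗ H :=
  tmap (@tmul k B) idfun (tassocV (tmap idfun delta x)).

Record right_galois_extension : Prop := RightGaloisExtension {
  right_galois_comodule : right_comodule_algebra;
  right_galois_coinv : forall b, delta b = b ⊗ 1 <-> exists c : k, b = c%:A;
  right_galois_can : bijective right_can
}.

End Right.

Definition has_dim (V : lmodType k) (n : nat) : Prop := inhabited (Vector.axiom n V).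

End GaloisExtensions.

Section Structures.
Variables (k : fieldType) (T : torsor k).

(* The Hopf algebra structure of H_l(T), resp. H_r(T): the identifications are
   made in T ⊗ (T^c ⊗ (T ⊗ T^c)), resp. T^c ⊗ (T ⊗ (T^c ⊗ T)). *)
Record is_Hl_hopf (hl : hopf_algebra (Hl T)) : Prop := IsHlHopf {
  Hl_comul : forall h, tassoc (tmap val val (comul hl h)) = mu_id (val h);
  Hl_counit : forall h, mul_op_r (val h) = (counit hl h)%:A
}.

Record is_Hr_hopf (hr : hopf_algebra (Hr T)) : Prop := IsHrHopf {
  Hr_comul : forall h, tassoc (tmap val val (comul hr h)) = id_mu (val h);
  Hr_counit : forall h, mul_op_l (val h) = (counit hr h)%:A
}.

Definition is_Hl_coaction (delta : {lrmorphism T -> Hl T ⊗ T}) : Prop :=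
  forall x, tassoc (tmap val idfun (delta x)) = mu T x.

Definition is_Hr_coaction (delta : {lrmorphism T -> T ⊗ Hr T}) : Prop :=
  forall x, tmap idfun val (delta x) = mu T x.

End Structures.

(* Main.v *)
From HB Require Import structures.
Require Import Defs.
From mathcomp Require Import all_boot all_algebra.
From mathcomp Require Import boolp.

Set Implicit Arguments.
Unset Strict Implicit.
Unset Printing Implicit Defensive.

Import GRing.Theory.
Local Open Scope ring_scope.

(* Write [mu x = x1 ⊗ x2 ⊗ x3]. An element of H_l(T), written [a ⊗ b] for a sum of
   such, satisfies [a1 ⊗ a2 ⊗ theta a3 ⊗ b = a ⊗ b3 ⊗ b2 ⊗ b1]. Multiplying suitable
   factors and using axioms (i) and (ii) gives
     [a1 ⊗ a2 ⊗ b (theta a3) = a ⊗ b ⊗ 1] and [a1 ⊗ (theta a3) a2 ⊗ b = a ⊗ 1 ⊗ b].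
   Multiplying the first two factors of the former, [ab ⊗ 1 = 1 ⊗ b (theta a)], so
   [ab = b (theta a)] is a scalar, which is the counit; the antipode is
   [a ⊗ b |-> b ⊗ theta a]. That the coproduct and the coaction land in the right
   tensor products follows from the exactness of tensoring over a field. The
   inverse of the canonical map is [(a ⊗ b) ⊗ y |-> a ⊗ by], and an [x] with
   [mu x = 1 ⊗ 1 ⊗ x] satisfies [x ⊗ 1 = 1 ⊗ x], hence is a scalar. H_r(T) is
   the mirror image, with antipode [a ⊗ b |-> theta b ⊗ a]. Finally
   [H ⊗ T ≅ T ⊗ T] gives [dim H * dim T = (dim T) ^ 2]. *)

(** * Tensor products over a field *)

Section TensorMaps.
Variable k : fieldType.

Lemma tmap_comp (A A' A'' B B' B'' : algType k)
    (f : {linear A' -> A''}) (f' : {linear A -> A'})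
    (g : {linear B' -> B''}) (g' : {linear B -> B'}) x :
  tmap f g (tmap f' g' x) = tmap (f \o f') (g \o g') x.
Proof.
elim/tensor_ind: x => [|a b x IH]; first by rewrite !linear0.
by rewrite !linearD /= IH !tmapE.
Qed.

Lemma eq_tmap (A A' B B' : algType k) (f f' : {linear A -> A'})
    (g g' : {linear B -> B'}) : f =1 f' -> g =1 g' -> tmap f g =1 tmap f' g'.
Proof.
by move=> ff gg; apply: tensor_linear_eq => u v /=; rewrite !tmapE ff gg.
Qed.

(** Functoriality for a pair of commutative squares, used to exchange one factorization for another
    on each tensor factor without writing out the composites. *)
Lemma tmap_square (A A1 A2 A' B B1 B2 B' : algType k)
    (f' : {linear A1 -> A'}) (f : {linear A -> A1})
    (h' : {linear A2 -> A'}) (h : {linear A -> A2})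
    (g' : {linear B1 -> B'}) (g : {linear B -> B1})
    (l' : {linear B2 -> B'}) (l : {linear B -> B2}) x :
  (forall a, f' (f a) = h' (h a)) -> (forall b, g' (g b) = l' (l b)) ->
  tmap f' g' (tmap f g x) = tmap h' l' (tmap h l x).
Proof. by move=> fh gl; rewrite !tmap_comp; apply: eq_tmap. Qed.

Lemma tmap_id (A B : algType k) (x : A ⊗ B) : tmap idfun idfun x = x.
Proof.
by elim/tensor_ind: x => [|a b x IH]; rewrite ?linear0// linearD /= IH tmapE.
Qed.

Lemma tmap_tswap (A A' B B' : algType k) (f : {linear A -> A'})
    (g : {linear B -> B'}) x : tmap f g (tswap x) = tswap (tmap g f x).
Proof.
elim/tensor_ind: x => [|a b x IH]; first by rewrite !linear0.
by rewrite !linearD /= IH !(tmapE, tswapE).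
Qed.

Lemma tswapK (A B : algType k) : cancel (@tswap k A B) (@tswap k B A).
Proof.
by elim/tensor_ind=> [|a b x IH]; rewrite ?linear0// !linearD /= IH !tswapE.
Qed.

Lemma tassocK (A B C : algType k) : cancel (@tassoc k A B C) (@tassocV k A B C).
Proof.
elim/tensor_ind3'=> [|a b c x IH]; first by rewrite !linear0.
by rewrite !linearD /= IH tassocE tassocVE.
Qed.

Lemma tassocVK (A B C : algType k) :
  cancel (@tassocV k A B C) (@tassoc k A B C).
Proof.
elim/tensor_ind3=> [|a b c x IH]; first by rewrite !linear0.
by rewrite !linearD /= IH tassocVE tassocE.
Qed.

Lemma tassocV_monoid (A B C : algType k) : monoid_morphism (@tassocV k A B C).
Proof.
have [a1 aM] := tassoc_monoid A B C.
split=> [|x y]; apply: (can_inj (@tassocK A B C)).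
  by rewrite tassocVK a1.
by rewrite aM !tassocVK.
Qed.

Lemma tassoc_tmap (A A' B B' C C' : algType k) (f : {linear A -> A'})
    (g : {linear B -> B'}) (h : {linear C -> C'}) x :
  tassoc (tmap (tmap f g) h x) = tmap f (tmap g h) (tassoc x).
Proof.
elim/tensor_ind3': x => [|a b c x IH]; first by rewrite !linear0.
by rewrite !linearD /= IH tassocE !tmapE /= !tmapE tassocE.
Qed.

(** * Contraction by functionals and exactness of the tensor product *)

Definition tcontract (A B : algType k) (f : {scalar A}) : A ⊗ B -> B :=
  tlift (fun a b => f a *: b).

Fact tcontract_bilinear (A B : algType k) (f : {scalar A}) :
  bilinear_fun (fun (a : A) (b : B) => f a *: b).
Proof.
split=> [b|a] c x y /=; first by rewrite linearP scalerDl scalerA.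
by rewrite scalerDr !scalerA [c * _]mulrC.
Qed.

HB.instance Definition _ (A B : algType k) (f : {scalar A}) :=
  GRing.isLinear.Build k _ _ _ (tcontract f)
    (tlift_linear (@tcontract_bilinear A B f)).

Lemma tcontractE (A B : algType k) (f : {scalar A}) (a : A) (b : B) :
  tcontract f (a ⊗ b) = f a *: b.
Proof. exact: (tlift_pure (@tcontract_bilinear A B f)). Qed.

Lemma tensor_sum (A B : algType k) (x : A ⊗ B) :
  exists n (u : 'I_n -> A) (v : 'I_n -> B), x = \sum_i u i ⊗ v i.
Proof.
elim/tensor_ind: x => [|a b x [n [u [v ->]]]].
  by exists 0, (fun=> 0), (fun=> 0); rewrite big_ord0.
exists n.+1, (fun i => oapp u a (unlift ord0 i)),
  (fun i => oapp v b (unlift ord0 i)).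
rewrite big_ord_recl unlift_none; congr (_ + _).
by apply: eq_bigr => i _; rewrite liftK.
Qed.

(* If [f (u i) != 0], a functional equal to 1 on it expresses [v i] through the
   other [v j]'s, which shortens the sum. *)
Lemma tensor_ker (A B C : algType k) (f : {linear A -> B}) (x : A ⊗ C) :
  tmap f idfun x = 0 ->
  exists n (u : 'I_n -> A) (v : 'I_n -> C),
    x = \sum_i u i ⊗ v i /\ forall i, f (u i) = 0.
Proof.
have [n [u [v ->]]] := tensor_sum x.
elim: n u v => [|n IH] u v fx0; first by exists 0, u, v; split=> // -[].
have [fu0|] := pselect (forall i, f (u i) = 0); first by exists n.+1, u, v.
move=> /existsNP[i /eqP /exists_functional[phi phi1]].
have vE : v i = - \sum_j phi (f (u (lift i j))) *: v (lift i j).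
  apply/eqP; rewrite -addr_eq0 -{1}[v i]scale1r -phi1.
  rewrite -(bigD1_ord i (P := predT) (F := fun j => phi (f (u j)) *: v j))//=.
  rewrite -[X in _ == X](linear0 (@tcontract B C phi)) -fx0
    (linear_sum (tmap f idfun)) linear_sum.
  by apply/eqP/eq_bigr => j _; rewrite /= tmapE tcontractE.
have xE : \sum_j u j ⊗ v j =
    \sum_j (u (lift i j) - phi (f (u (lift i j))) *: u i) ⊗ v (lift i j).
  rewrite (bigD1_ord i)//= {1}vE -[u i ⊗ - _]/(tpurel (u i) (- _)) linearN.
  rewrite linear_sum addrC -sumrB; apply: eq_bigr => j _.
  by rewrite /= /tpurel tpureZr -tpureZl -scaleN1r -tpureZl -tpureDl scaleN1r.
by rewrite xE; apply: IH; rewrite -xE.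
Qed.

Lemma tmap_idr_inj (A B C : algType k) (f : {linear A -> B}) :
  injective f -> injective (tmap f (@idfun C)).
Proof.
move=> finj; apply: raddf_inj => x /tensor_ker[n [u [v [-> fu0]]]].
apply: big1 => i _; suff -> : u i = 0 by rewrite tpure0l.
by apply: finj; rewrite fu0 linear0.
Qed.

Lemma tmap_idl_inj (A B C : algType k) (f : {linear A -> B}) :
  injective f -> injective (tmap (@idfun C) f).
Proof.
move=> finj x y fxy; apply: (can_inj (@tswapK _ _)).
by apply: (tmap_idr_inj finj); rewrite !tmap_tswap fxy.
Qed.

Lemma tmap_inj (A B C D : algType k)
    (f : {linear A -> B}) (g : {linear C -> D}) :
  injective f -> injective g -> injective (tmap f g).
Proof.
move=> finj ginj x y fgxy.
apply: (tmap_idl_inj ginj); apply: (tmap_idr_inj finj).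
by rewrite !tmap_comp.
Qed.

Section Equalizer.
Variables (H A B : algType k) (i : {linear H -> A}) (f g : {linear A -> B}).
Hypothesis imi : forall a, f a = g a -> exists h, i h = a.

(** The difference [f \- g] kills [x] after tensoring, so [tensor_ker] writes [x] with left factors
    equalized by [f] and [g], and each of these lifts along [i]. *)
Lemma tensor_eqr (C : algType k) (x : A ⊗ C) :
  tmap f idfun x = tmap g idfun x -> exists y, tmap i idfun y = x.
Proof.
move=> fgx; have : tmap (f \- g) idfun x = 0.
  have -> : tmap (f \- g) idfun x = tmap f idfun x - tmap g idfun x.
    elim/tensor_ind: x {fgx} => [|a c x IH]; first by rewrite !linear0 addr0.
    rewrite !linearD /= IH !tmapE /= ?opprD [RHS]addrACA; congr (_ + _).
    by rewrite -[in RHS]scaleN1r -tpureZl scaleN1r -tpureDl.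
  by rewrite fgx subrr.
move=> /tensor_ker[n [u [v [-> fg0]]]].
have {}fg0 j : exists h, i h = u j.
  by apply: imi; apply/eqP; rewrite -subr_eq0; apply/eqP/fg0.
have [h hE] := choice fg0; exists (\sum_j h j ⊗ v j).
rewrite (linear_sum (tmap i idfun)).
by apply: eq_bigr => j _; rewrite /= tmapE hE.
Qed.

Lemma tensor_eql (C : algType k) (x : C ⊗ A) :
  tmap idfun f x = tmap idfun g x -> exists y, tmap idfun i y = x.
Proof.
move=> fgx; have /tensor_eqr[y yE] :
    tmap f idfun (tswap x) = tmap g idfun (tswap x).
  by rewrite !tmap_tswap fgx.
by exists (tswap y); rewrite tmap_tswap yE tswapK.
Qed.

(** The left factor is lifted first; injectivity of [tmap i idfun] carries the second equation over
    to this lift, whose right factor then lifts too. *)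
Lemma tensor_eqlr (x : A ⊗ A) : injective i ->
  tmap f idfun x = tmap g idfun x -> tmap idfun f x = tmap idfun g x ->
  exists y, tmap i i y = x.
Proof.
move=> iinj /tensor_eqr[y <-]; rewrite !tmap_comp => fgy.
have /tensor_eql[z <-] : tmap idfun f y = tmap idfun g y.
  by apply: (tmap_idr_inj iinj); rewrite !tmap_comp.
by exists z; rewrite tmap_comp.
Qed.

End Equalizer.

Lemma linear_factor (V : lmodType k) (W X : lmodType k) (i : {linear V -> W})
    (f : {linear X -> W}) : injective i -> (forall x, exists y, i y = f x) ->
  exists g : {linear X -> V}, forall x, i (g x) = f x.
Proof.
move=> iinj /choice[g gE].
have glin : linear g by move=> a x y; apply: iinj; rewrite linearP !gE linearP.
pose gM := GRing.isLinear.Build k X V _ g glin.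
by exists (HB.pack_for {linear X -> V} g gM).
Qed.

(** Coproducts, counits and coactions are all obtained by this corestriction: uniqueness of
    preimages makes a pointwise choice linear and multiplicative. *)
Lemma lrmorphism_factor (A B C : algType k) (i : {linear A -> B})
    (f : {linear C -> B}) : injective i -> monoid_morphism i ->
    monoid_morphism f -> (forall x, exists y, i y = f x) ->
  exists g : {lrmorphism C -> A}, forall x, i (g x) = f x.
Proof.
move=> iinj [i1 iM] [f1 fM] /(linear_factor iinj)[g gE].
have gmon : monoid_morphism g.
  by split=> [|x y]; apply: iinj; rewrite ?iM !gE ?i1 ?f1 ?fM.
pose gL := GRing.isLinear.Build k C A _ g (@linearP _ _ _ _ g).
pose gR := GRing.isMonoidMorphism.Build C A g gmon.
by exists (HB.pack_for {lrmorphism C -> A} (g : C -> A) gL gR).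
Qed.

End TensorMaps.

Section ScalarMap.
Variables (k : fieldType) (C : algType k).

(** The unit map of [C], with source [k^o] so that a counit arises by corestriction along it. *)
Definition scalar_map : k^o -> C := fun c => c%:A.

Fact scalar_map_linear : linear scalar_map.
Proof. by move=> a x y; rewrite /scalar_map scalerDl scalerA. Qed.

HB.instance Definition _ := GRing.isLinear.Build k _ _ _ scalar_map
  scalar_map_linear.

Fact scalar_map_monoid : monoid_morphism scalar_map.
Proof.
by split=> [|x y]; [apply: (rmorph1 (in_alg C)) | apply: (rmorphM (in_alg C))].
Qed.

HB.instance Definition _ := GRing.isMonoidMorphism.Build k^o C scalar_map
  scalar_map_monoid.

Lemma scalar_map_inj : injective scalar_map.
Proof. exact: (fmorph_inj (in_alg C)). Qed.

End ScalarMap.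

Lemma tmul_tmap (k : fieldType) (A B : algType k) (f : {linear A -> B}) x :
  monoid_morphism f -> tmul (tmap f f x) = f (tmul x).
Proof.
move=> [_ fM]; elim/tensor_ind: x => [|a b x IH]; first by rewrite !linear0.
by rewrite !linearD /= IH tmapE !tmul_pure fM.
Qed.

(** * Hopf algebras inside an algebra with a coproduct *)

Section HopfSubalgebra.
Variables (k : fieldType) (H A B T : algType k).
Variables (i : {linear H -> A}) (f g : {linear A -> B}).
(* [el] and [er] need only agree on [H]: each of the two counit laws holds for
   one of them. *)
Variables (D : {linear A -> (A ⊗ A)%type}) (el er : {linear A -> T}).
Variable S : {linear A -> A}.

Hypothesis i_monoid : monoid_morphism i.
Hypothesis i_inj : injective i.
Hypothesis im_i : forall a, f a = g a -> exists h, i h = a.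
Hypothesis D_monoid : monoid_morphism D.
Hypothesis D_coassoc : forall x,
  tassoc (tmap D idfun (D x)) = tmap idfun D (D x).
Hypothesis D_eqr : forall h,
  tmap f idfun (D (i h)) = tmap g idfun (D (i h)).
Hypothesis D_eql : forall h,
  tmap idfun f (D (i h)) = tmap idfun g (D (i h)).
Hypothesis el1 : el 1 = 1.
Hypothesis elM : forall h h', el (i h * i h') = el (i h) * el (i h').
Hypothesis el_scalar : forall h, exists c : k, el (i h) = c%:A.
Hypothesis el_er : forall h, el (i h) = er (i h).
Hypothesis counitl : forall h, tmap el idfun (D (i h)) = 1 ⊗ i h.
Hypothesis counitr : forall h, tmap idfun er (D (i h)) = i h ⊗ 1.
Hypothesis S_im : forall h, exists h', i h' = S (i h).
Hypothesis S_convl : forall h c, el (i h) = c%:A ->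
  tmul (tmap S idfun (D (i h))) = c%:A.
Hypothesis S_convr : forall h c, el (i h) = c%:A ->
  tmul (tmap idfun S (D (i h))) = c%:A.

(** Every structure map is the corestriction of an ambient one. Each axiom is tested after an
    injection built from [i] and [scalar_map], where it reduces to a hypothesis. *)
Lemma hopf_subalgebra : exists hH : hopf_algebra H,
  (forall h, tmap i i (comul hH h) = D (i h)) /\
  (forall h, el (i h) = (counit hH h)%:A).
Proof.
have [cm cmE] : exists cm : {lrmorphism H -> (H ⊗ H)%type},
    forall h, tmap i i (cm h) = D (i h).
  apply: (lrmorphism_factor (f := D \o i)).
  - exact: tmap_inj.
  - exact: tmap_monoid.
  - exact: comp_monoid D_monoid i_monoid.
  - by move=> h; apply: (tensor_eqlr im_i i_inj (D_eqr h) (D_eql h)).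
have [cu cuE] : exists cu : {lrmorphism H -> k^o},
    forall h, scalar_map T (cu h) = el (i h).
  apply: (lrmorphism_factor (f := el \o i)).
  - exact: scalar_map_inj.
  - exact: lrmorphism_monoid.
  - by split=> [|x y] /=; rewrite ?i_monoid.1 ?el1 ?i_monoid.2 ?elM.
  - by move=> h; have [c cE] := el_scalar h; exists c; rewrite /= cE.
have [an anE] : exists an : {linear H -> H}, forall h, i (an h) = S (i h).
  exact: (linear_factor (f := S \o i)).
unshelve eexists.
  apply: (@HopfAlgebra k H cm cu an) => h.
  - apply: (tmap_inj i_inj (tmap_inj i_inj i_inj)); rewrite -tassoc_tmap.
    rewrite (tmap_square (h' := D) (h := i) (l' := idfun) (l := i) _ cmE)//.
    rewrite cmE D_coassoc -cmE.
    by apply: tmap_square => // x; rewrite /= cmE.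
  - apply: (tmap_inj (@scalar_map_inj k T) i_inj).
    rewrite (tmap_square (h' := el) (h := i) (l' := idfun) (l := i) _ cuE)//.
    by rewrite cmE counitl tmapE rmorph1.
  - apply: (tmap_inj i_inj (@scalar_map_inj k T)).
    have cuEr x : scalar_map T (cu x) = er (i x) by rewrite cuE.
    rewrite (tmap_square (h' := idfun) (h := i) (l' := er) (l := i) _ _ cuEr)//.
    by rewrite cmE counitr tmapE rmorph1.
  - apply: i_inj; rewrite -tmul_tmap//.
    rewrite (tmap_square (h' := S) (h := i) (l' := idfun) (l := i) _ anE)//.
    by rewrite cmE (S_convl (esym (cuE h))) linearZ /= i_monoid.1.
  - apply: i_inj; rewrite -tmul_tmap//.
    rewrite (tmap_square (h' := idfun) (h := i) (l' := S) (l := i) _ _ anE)//.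
    by rewrite cmE (S_convr (esym (cuE h))) linearZ /= i_monoid.1.
by split=> h //=; rewrite -cuE.
Qed.

End HopfSubalgebra.

(** * Multilinear induction *)

Section Additivity.

Lemma zero_step (k : fieldType) (U V : lmodType k) (f : {linear U -> V}) x :
  x = 0 -> f x = 0.
Proof. by move=> ->; apply: linear0. Qed.

Lemma add_step (k : fieldType) (U V : lmodType k) (f : {linear U -> V}) x a b :
  x = a + b -> f x = f a + f b.
Proof. by move=> ->; apply: linearD. Qed.

Lemma tpure_zero_stepl (k : fieldType) (U V : algType k) (u : U) (v : V) :
  u = 0 -> u ⊗ v = 0.
Proof. by move=> ->; apply: tpure0l. Qed.

Lemma tpure_zero_stepr (k : fieldType) (U V : algType k) (u : U) (v : V) :
  v = 0 -> u ⊗ v = 0.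
Proof. by move=> ->; apply: tpure0r. Qed.

Lemma tpure_add_stepl (k : fieldType) (U V : algType k) (u a b : U) (v : V) :
  u = a + b -> u ⊗ v = a ⊗ v + b ⊗ v.
Proof. by move=> ->; apply: tpureDl. Qed.

Lemma tpure_add_stepr (k : fieldType) (U V : algType k) (u : U) (v a b : V) :
  v = a + b -> u ⊗ v = u ⊗ a + u ⊗ b.
Proof. by move=> ->; apply: tpureDr. Qed.

(** The shape of an additive induction step: [l2 = r2] is the induction hypothesis, and [l1 = r1]
    the remaining identity for one pure tensor. *)
Lemma eq_from_split (V : nmodType) (l r l1 l2 r1 r2 : V) :
  l = l1 + l2 -> r = r1 + r2 -> l2 = r2 -> l1 = r1 -> l = r.
Proof. by move=> -> -> -> ->. Qed.

End Additivity.

(* Splitting along an addition by following the unique path to it is much faster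
   than rewriting with [linearD], whose pattern matches every application. *)
Ltac push_zero :=
  lazymatch goal with
  | |- GRing.zero = _ => reflexivity
  | |- tpure ?u _ = _ =>
    lazymatch u with
    | context [GRing.zero] => eapply tpure_zero_stepl
    | _ => eapply tpure_zero_stepr
    end; push_zero
  | |- _ => apply: zero_step; push_zero
  end.
Ltac push_add z :=
  lazymatch goal with
  | |- GRing.add _ z = _ => reflexivity
  | |- tpure ?u _ = _ =>
    lazymatch u with
    | context [z] => eapply tpure_add_stepl
    | _ => eapply tpure_add_stepr
    end; push_add z
  | |- _ => apply: add_step; push_add z
  end.
Ltac split_add z IH :=
  eapply eq_from_split;
  [push_add z | push_add z | exact: IH | clear z IH; rewrite /=].
(* Applied to [mu a], these tactics replace Sweedler notation: an identity additive in [mu a] is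
   reduced to one whose components are variables. *)
Tactic Notation "tensor_elim2" constr(y) "as" ident(u) ident(v) :=
  let z := fresh "z" in let IH := fresh "IH" in
  rewrite /=; elim/tensor_ind: y => [|u v z IH];
  [etransitivity; [| symmetry]; push_zero | split_add z IH].
Tactic Notation "tensor_elim3" constr(y) "as" ident(u) ident(v) ident(w) :=
  let z := fresh "z" in let IH := fresh "IH" in
  rewrite /=; elim/tensor_ind3: y => [|u v w z IH];
  [etransitivity; [| symmetry]; push_zero | split_add z IH].
Ltac tensorE :=
  repeat progress rewrite /= ?(tmapE, tassocE, tassocVE, tassoc3E, tswapE,
    tau13E, tmul_pure, tmulE).

(** * Reversal of factors and products with the opposite algebra *)

Section TensorOpposite.
Variables (k : fieldType).

Definition tflip14 (U V W X : algType k) :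
    (U ⊗ (V ⊗ (W ⊗ X)))%type -> (X ⊗ (W ⊗ (V ⊗ U)))%type :=
  @tassoc3 k X W V U \o @tswap k _ _ \o tmap idfun (@tflip13 k V W X).
HB.instance Definition _ (U V W X : algType k) :=
  GRing.Linear.on (@tflip14 U V W X).

Lemma tflip14E (U V W X : algType k) (u : U) (v : V) (w : W) (x : X) :
  tflip14 (u ⊗ (v ⊗ (w ⊗ x))) = x ⊗ (w ⊗ (v ⊗ u)).
Proof. by rewrite /tflip14 /= tmapE /= tflip13E tswapE tassoc3E. Qed.

Definition mul_rev_l (T : algType k) : (T ⊗ T^c)%type -> T :=
  @tmul k T \o tmap (of_op T) idfun \o @tswap k T T^c.
HB.instance Definition _ (T : algType k) := GRing.Linear.on (@mul_rev_l T).

Definition mul_rev_r (T : algType k) : (T^c ⊗ T)%type -> T :=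
  @tmul k T \o tmap idfun (of_op T) \o @tswap k T^c T.
HB.instance Definition _ (T : algType k) := GRing.Linear.on (@mul_rev_r T).

Lemma mul_rev_lE (T : algType k) (a : T) (b : T^c) :
  mul_rev_l (a ⊗ b) = of_op T b * a.
Proof. by rewrite /mul_rev_l; tensorE. Qed.

Lemma mul_rev_rE (T : algType k) (a : T^c) (b : T) :
  mul_rev_r (a ⊗ b) = b * of_op T a.
Proof. by rewrite /mul_rev_r; tensorE. Qed.

Lemma mul_op_rE (T : algType k) (a : T) (b : T^c) :
  mul_op_r (a ⊗ b) = a * of_op T b.
Proof. by rewrite /mul_op_r; tensorE. Qed.

Lemma mul_op_lE (T : algType k) (a : T^c) (b : T) :
  mul_op_l (a ⊗ b) = of_op T a * b.
Proof. by rewrite /mul_op_l; tensorE. Qed.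

(** Multiplying the factors gives [u = v]; a functional with value 1 at 1, applied to the second
    factor, gives [u = f v]. Both the counits and the coinvariants rely on this. *)
Lemma tpure1_scalar (T : algType k) (u v : T) :
  u ⊗ 1 = 1 ⊗ v -> u = v /\ exists c : k, u = c%:A.
Proof.
move=> uv; split.
  by have := congr1 (@tmul k T) uv; tensorE; rewrite mulr1 mul1r.
have [f f1] := exists_functional (oner_neq0 T); exists (f v).
have := congr1 (tcontract f \o @tswap k T T) uv; rewrite /= !tswapE !tcontractE.
by rewrite f1 scale1r.
Qed.

End TensorOpposite.

Section CanonicalMaps.
Variables (k : fieldType) (H B : algType k).

Fact left_can_linear (delta : {lrmorphism B -> (H ⊗ B)%type}) :
  linear (left_can delta).
Proof. by move=> a x y; rewrite /left_can !linearP. Qed.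

HB.instance Definition _ delta := GRing.isLinear.Build k _ _ _ (left_can delta)
  (left_can_linear delta).

Fact right_can_linear (delta : {lrmorphism B -> (B ⊗ H)%type}) :
  linear (right_can delta).
Proof. by move=> a x y; rewrite /right_can !linearP. Qed.

HB.instance Definition _ delta := GRing.isLinear.Build k _ _ _ (right_can delta)
  (right_can_linear delta).

End CanonicalMaps.

(** * The Hopf algebra H_l(T) *)

Section LeftHopf.
Variables (k : fieldType) (T : torsor k).
Local Notation mu := (mu T).
Local Notation theta := (theta T).
Local Notation mu_op := (mu_op mu).
Local Notation A := (T ⊗ T^c)%type.

Definition Hl_lhs : A -> (T ⊗ (T^c ⊗ (T ⊗ T^c)))%type :=
  tmap idfun (tmap idfun (tmap theta idfun)) \o
  (@tassoc3 _ _ _ _ _ \o tmap mu idfun).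
HB.instance Definition _ := GRing.Linear.on Hl_lhs.
Definition Hl_rhs : A -> (T ⊗ (T^c ⊗ (T ⊗ T^c)))%type := tmap idfun mu_op.
HB.instance Definition _ := GRing.Linear.on Hl_rhs.

Lemma in_HlE x : in_Hl x <-> Hl_lhs x = Hl_rhs x.
Proof. by split=> /eqP. Qed.

Lemma Hl_lhsE a b : Hl_lhs (a ⊗ b) =
  tmap idfun (tmap idfun (tmap theta idfun)) (tassoc3 (mu a ⊗ b)).
Proof. by rewrite /Hl_lhs /= tmapE. Qed.

Lemma Hl_rhsE a b : Hl_rhs (a ⊗ b) = a ⊗ tau13 (mu (of_op T b)).
Proof. by rewrite /Hl_rhs tmapE. Qed.

Lemma val_Hl_eq (h : Hl T) : Hl_lhs (val h) = Hl_rhs (val h).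
Proof. exact/in_HlE/valP. Qed.

Lemma Hl_val_im x : Hl_lhs x = Hl_rhs x -> exists h : Hl T, val h = x.
Proof. by move=> /in_HlE xH; exists (MkHl xH). Qed.

(** * The left coaction, the coproduct, and stability of the defining equation *)

Definition lcoact : T -> (A ⊗ T)%type := @tassocV k T T^c T \o mu.
HB.instance Definition _ := GRing.Linear.on lcoact.

Lemma lcoact_monoid : monoid_morphism lcoact.
Proof. exact: comp_monoid (tassocV_monoid _ _ _) (lrmorphism_monoid mu). Qed.

(* [a ⊗ y |-> (a1 ⊗ a2) ⊗ (a3 ⊗ y)]; for [Y = T^c] this is the coproduct. *)
Definition lcoactT (Y : algType k) : (T ⊗ Y)%type -> (A ⊗ (T ⊗ Y))%type :=
  @tassoc k A T Y \o tmap lcoact idfun.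
HB.instance Definition _ (Y : algType k) := GRing.Linear.on (@lcoactT Y).
Local Notation Dl := (@lcoactT T^c).

Lemma lcoactTE (Y : algType k) a (y : Y) :
  lcoactT (a ⊗ y) = tmap idfun (@tpurer k T Y y) (lcoact a).
Proof.
rewrite /lcoactT /= tmapE; tensor_elim2 (lcoact a) as u v.
by tensorE; rewrite /tpurer.
Qed.

Lemma lcoactT_nat (Y Z : algType k) (f : {linear Y -> Z}) x :
  lcoactT (tmap idfun f x) = tmap idfun (tmap idfun f) (lcoactT x).
Proof.
tensor_elim2 x as a b; tensorE; rewrite !lcoactTE tmap_comp.
by apply: eq_tmap => // c; rewrite /= /tpurer tmapE.
Qed.

(** This is axiom (iii) with the first two of the five factors grouped. *)
Lemma lcoact_mu a : lcoactT (mu a) = tmap idfun mu (lcoact a).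
Proof.
have := congr1 (@tassocV k _ _ _) (mu_coassoc (torsorP T) a) => /esym.
congr (_ = _).
  tensor_elim3 (mu a) as u v w; rewrite lcoactTE; tensorE; rewrite /lcoact /=.
  by tensor_elim3 (mu u) as p q r; tensorE.
by rewrite /lcoact /=; tensor_elim3 (mu a) as u v w; tensorE.
Qed.

Lemma lcoact_coassoc a :
  tassoc (tmap Dl idfun (lcoact a)) = tmap idfun lcoact (lcoact a).
Proof.
have -> : tmap idfun lcoact (lcoact a) =
    tmap idfun (@tassocV k T T^c T) (tmap idfun mu (lcoact a)).
  by rewrite tmap_comp; apply: eq_tmap.
rewrite -lcoact_mu {1}/lcoact /=.
tensor_elim3 (mu a) as u v w; tensorE; rewrite !lcoactTE.
by tensor_elim2 (lcoact u) as x y; tensorE; rewrite /tpurer; tensorE.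
Qed.

Lemma lcoactT_coassoc x : tassoc (tmap Dl idfun (Dl x)) = tmap idfun Dl (Dl x).
Proof.
tensor_elim2 x as a b; rewrite lcoactTE.
have -> : tmap idfun Dl (tmap idfun (tpurer b) (lcoact a)) =
    tmap idfun (tmap idfun (tpurer b)) (tmap idfun lcoact (lcoact a)).
  by apply: tmap_square => // c; rewrite /= -lcoactTE.
rewrite -lcoact_coassoc -tassoc_tmap; congr tassoc.
by apply: tmap_square => // c; rewrite /= tmap_id.
Qed.

Lemma lcoactT_monoid : monoid_morphism Dl.
Proof.
apply: comp_monoid (tassoc_monoid _ _ _) _.
by apply: tmap_monoid; [apply: lcoact_monoid | apply: idfun_monoid].
Qed.

(** This is axiom (iv) regrouped; it makes the coaction land in [Hl T ⊗ T]. *)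
Lemma lcoact_Hl (x : T) :
  tmap Hl_lhs idfun (lcoact x) = tmap Hl_rhs idfun (lcoact x).
Proof.
rewrite /lcoact /=; apply: (can_inj (@tassocK k _ _ _)).
have := congr1
  (tmap idfun (@tassocV k _ _ _ \o tmap idfun (@tassocV k T T^c T)))
  (mu_theta3 (torsorP T) x); congr (_ = _).
  tensor_elim3 (mu x) as u v w; tensorE; rewrite Hl_lhsE.
  by tensor_elim3 (mu u) as p q r; tensorE.
tensor_elim3 (mu x) as u v w; tensorE; rewrite Hl_rhsE.
rewrite /Defs.mu_op /=; tensorE.
by tensor_elim3 (mu (of_op T v)) as p q r; tensorE.
Qed.

Lemma lcoactT_mu_id x : tassoc (Dl x) = mu_id x.
Proof.
rewrite /mu_id; tensor_elim2 x as a b; rewrite lcoactTE /lcoact; tensorE.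
by tensor_elim3 (mu a) as u v w; tensorE; rewrite /tpurer.
Qed.

(** The left leg of the coproduct comes from the coaction on [a], with [b] carried along, so the
    equation holds for every [x] of [A]. *)
Lemma lcoactT_Hl x : tmap Hl_lhs idfun (Dl x) = tmap Hl_rhs idfun (Dl x).
Proof.
tensor_elim2 x as a b; rewrite lcoactTE.
rewrite (tmap_square (h' := idfun)
  (l' := tpurer b) (l := idfun) (h := Hl_lhs))//.
by rewrite lcoact_Hl; apply: tmap_square.
Qed.

(** Coassociativity lets the coaction on the first factor pass through [Hl_lhs]; for [Hl_rhs], which
    leaves that factor alone, naturality is enough. The right leg of the coproduct thus inherits the
    equation of [x]. *)
Lemma lcoactT_lhs x : tmap idfun Hl_lhs (Dl x) = lcoactT (Hl_lhs x).
Proof.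
tensor_elim2 x as a b; rewrite lcoactTE.
have thE y z : Hl_lhs (y ⊗ z) =
    tmap idfun (tmap idfun (@tpurer k T T^c z \o theta)) (mu y).
  by rewrite Hl_lhsE; tensor_elim3 (mu y) as p q r; tensorE.
rewrite thE lcoactT_nat lcoact_mu !tmap_comp; apply: eq_tmap => // c.
by rewrite /= /tpurer thE.
Qed.

Lemma lcoactT_rhs x : tmap idfun Hl_rhs (Dl x) = lcoactT (Hl_rhs x).
Proof. by rewrite lcoactT_nat. Qed.

Lemma lcoactT_idl_Hl x : Hl_lhs x = Hl_rhs x ->
  tmap idfun Hl_lhs (Dl x) = tmap idfun Hl_rhs (Dl x).
Proof. by move=> xH; rewrite lcoactT_lhs lcoactT_rhs xH. Qed.

(** * The counit of H_l(T) *)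

Definition mul_theta_l : A -> T := @mul_rev_l k T \o tmap theta idfun.
HB.instance Definition _ := GRing.Linear.on mul_theta_l.

Lemma mul_theta_lE a b : mul_theta_l (a ⊗ b) = of_op T b * theta a.
Proof. by rewrite /mul_theta_l /= tmapE mul_rev_lE. Qed.

Lemma lcoact_counit a : tmap (@mul_op_r k T) idfun (lcoact a) = 1 ⊗ a.
Proof. exact: mu_mull (torsorP T) a. Qed.

Lemma lcoactT_counitl x : tmap (@mul_op_r k T) idfun (Dl x) = 1 ⊗ x.
Proof.
tensor_elim2 x as a b; rewrite lcoactTE.
rewrite (tmap_square (h' := idfun) (h := @mul_op_r k T)
  (l' := tpurer b) (l := idfun))//.
by rewrite lcoact_counit tmapE.
Qed.

(** Multiplying the last two factors of the defining equation in reverse order gives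
    [a1 ⊗ a2 ⊗ b (theta a3)] on the left and [a ⊗ b3 ⊗ b1 b2] on the right, which axiom (ii)
    collapses. *)
Lemma lcoactT_counitr x : Hl_lhs x = Hl_rhs x ->
  tmap idfun mul_theta_l (Dl x) = x ⊗ 1.
Proof.
move=> /(congr1 (@tassocV k _ _ _ \o tmap idfun (tmap idfun (@mul_rev_l k T)))).
congr (_ = _).
  tensor_elim2 x as a b; rewrite Hl_lhsE lcoactTE.
  rewrite /lcoact /=; tensor_elim3 (mu a) as p q r; tensorE.
  by rewrite /tpurer mul_theta_lE mul_rev_lE.
tensor_elim2 x as a b; rewrite Hl_rhsE; tensorE.
have -> : tmap idfun (@mul_rev_l k T) (tau13 (mu (of_op T b))) =
    tswap (tmap idfun (to_op T)
      (tmap (@mul_op_r k T) idfun (lcoact (of_op T b)))).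
  rewrite /lcoact /=; tensor_elim3 (mu (of_op T b)) as p q r; tensorE.
  by rewrite mul_rev_lE mul_op_rE.
by rewrite lcoact_counit; tensorE.
Qed.

Lemma mul_op_r_Hl x : Hl_lhs x = Hl_rhs x ->
  mul_op_r x = mul_theta_l x /\ exists c : k, mul_op_r x = c%:A.
Proof.
move=> xH; apply: tpure1_scalar.
have := congr1 (tmap (@mul_op_r k T) idfun) (lcoactT_counitr xH).
rewrite tmapE => <-.
rewrite (tmap_square (h' := idfun) (h := @mul_op_r k T)
  (l' := mul_theta_l) (l := idfun))//.
by rewrite lcoactT_counitl tmapE.
Qed.

(** In [mul_op_r (x * y)] the product of the factors of [y] sits between the factors of [x]; being a
    scalar, it can be pulled out. *)
Lemma mul_op_rM x y c :
  mul_op_r y = c%:A -> mul_op_r (x * y) = c *: mul_op_r x :> T.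
Proof.
move=> yc; elim/tensor_ind: x => [|a b x IH].
  by rewrite mul0r !linear0.
rewrite mulrDl !linearD /= IH ?scalerDr; congr (_ + _).
have -> : mul_op_r ((a ⊗ b) * y) = a * mul_op_r y * of_op T b.
  elim/tensor_ind: y {yc IH} => [|u v y IH].
    by rewrite mulr0 !linear0 mulr0 mul0r.
  rewrite mulrDr !linearD /= IH mulrDr mulrDl tmulE !mul_op_rE.
  by rewrite of_opM !mulrA.
by rewrite yc mul_op_rE -scalerAr mulr1 -scalerAl.
Qed.

(** * The antipode of H_l(T) *)

Definition antipode_l : A -> A :=
  tmap (of_op T) (to_op T \o theta) \o @tswap k T T^c.
HB.instance Definition _ := GRing.Linear.on antipode_l.

Lemma antipode_lE a b : antipode_l (a ⊗ b) = of_op T b ⊗ to_op T (theta a).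
Proof. by rewrite /antipode_l; tensorE. Qed.

(** The convolution is [a2 a3 ⊗ b (theta a1)], and axiom (i) collapses [a2 a3]. *)
Lemma antipode_l_convl x :
  tmul (tmap antipode_l idfun (Dl x)) = 1 ⊗ to_op T (mul_theta_l x).
Proof.
tensor_elim2 x as a b; rewrite lcoactTE /lcoact /=.
have := congr1
  (tmap idfun (to_op T \o lmul (of_op T b) \o theta) \o @tswap k _ _)
  (mu_mulr (torsorP T) a) => /=; rewrite tswapE tmapE /= mul_theta_lE => <-.
by tensor_elim3 (mu a) as p q r; tensorE; rewrite /tpurer antipode_lE tmulE
  mul_op_lE.
Qed.

(** The convolution is [a1 b ⊗ (theta a3) a2]; the defining equation turns it into [a b1 ⊗ b2 b3],
    and axiom (i) into [ab ⊗ 1]. *)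
Lemma antipode_l_convr x : Hl_lhs x = Hl_rhs x ->
  tmul (tmap idfun antipode_l (Dl x)) = mul_op_r x ⊗ 1.
Proof.
(* [F] is [p ⊗ q ⊗ r ⊗ s |-> p s ⊗ r q]. *)
pose F : {linear (T ⊗ (T^c ⊗ (T ⊗ T^c)))%type -> A} :=
  tmap (@mul_op_r k T) (to_op T \o @mul_rev_r k T) \o @tassocV k _ _ _ \o
  tmap idfun (@tswap k _ _ \o @tassocV k T^c T T^c).
move=> /(congr1 F); congr (_ = _).
  tensor_elim2 x as a b; rewrite Hl_lhsE lcoactTE /lcoact /=.
  tensor_elim3 (mu a) as p q r; tensorE; rewrite /tpurer antipode_lE.
  by rewrite mul_op_rE mul_rev_rE; tensorE.
tensor_elim2 x as a b; rewrite Hl_rhsE; tensorE.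
have := congr1 (tmap (lmul a) (to_op T)) (mu_mulr (torsorP T) (of_op T b)).
rewrite tmapE /lmul /= mul_op_rE => <-.
tensor_elim3 (mu (of_op T b)) as p q r; tensorE.
by rewrite mul_op_lE mul_op_rE mul_rev_rE.
Qed.

(** Reversing the four factors and twisting two of them by [theta] exchanges the two sides of the
    equation; axiom (v) moves [theta] through [mu]. *)
Lemma antipode_l_Hl x : Hl_lhs x = Hl_rhs x ->
  Hl_lhs (antipode_l x) = Hl_rhs (antipode_l x).
Proof.
(* [P] is [p ⊗ q ⊗ r ⊗ s |-> s ⊗ r ⊗ theta q ⊗ theta p]. *)
pose P : {linear (T ⊗ (T^c ⊗ (T ⊗ T^c)))%type ->
    (T ⊗ (T^c ⊗ (T ⊗ T^c)))%type} :=
  tmap (of_op T) (tmap (to_op T)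
    (tmap (of_op T \o theta_op theta) (to_op T \o theta))) \o @tflip14 k _ _ _ _.
move=> /(congr1 P)/esym; congr (_ = _).
  tensor_elim2 x as a b; rewrite Hl_rhsE antipode_lE Hl_lhsE.
  by tensor_elim3 (mu (of_op T b)) as p q r; tensorE; rewrite tflip14E; tensorE.
tensor_elim2 x as a b; rewrite Hl_lhsE antipode_lE Hl_rhsE.
rewrite -(mu_theta (torsorP T)).
by tensor_elim3 (mu a) as p q r; tensorE; rewrite tflip14E; tensorE.
Qed.

Lemma val_Hl_monoid : monoid_morphism (val : Hl T -> A).
Proof. by split; [apply: rmorph1 | apply: rmorphM]. Qed.

Lemma Hl_hopf : exists hl : hopf_algebra (Hl T),
  (forall h, tmap val val (comul hl h) = Dl (val h)) /\
  (forall h, mul_op_r (val h) = (counit hl h)%:A).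
Proof.
apply: (@hopf_subalgebra k (Hl T) A _ T val Hl_lhs Hl_rhs Dl (@mul_op_r k T)
  mul_theta_l antipode_l).
- exact: val_Hl_monoid.
- exact: val_inj.
- exact: Hl_val_im.
- exact: lcoactT_monoid.
- exact: lcoactT_coassoc.
- by move=> h; apply: lcoactT_Hl.
- by move=> h; apply/lcoactT_idl_Hl/val_Hl_eq.
- by rewrite /= toneE mul_op_rE /= mulr1.
- move=> h h' /=; have [_ [c cE]] := mul_op_r_Hl (val_Hl_eq h').
  by rewrite (mul_op_rM _ cE) cE -scalerAr mulr1.
- by move=> h; case: (mul_op_r_Hl (val_Hl_eq h)).
- by move=> h; case: (mul_op_r_Hl (val_Hl_eq h)).
- by move=> h; apply: lcoactT_counitl.
- by move=> h; apply/lcoactT_counitr/val_Hl_eq.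
- by move=> h; apply/Hl_val_im/antipode_l_Hl/val_Hl_eq.
- move=> h c hc; rewrite /= antipode_l_convl.
  by have [<- _] := mul_op_r_Hl (val_Hl_eq h); rewrite hc linearZ tpureZr.
- move=> h c hc; rewrite /= antipode_l_convr; last exact: val_Hl_eq.
  by rewrite hc tpureZl.
Qed.

(** * Coinvariants and the left Galois property *)

Lemma mu_coinv (b : T) : mu b = 1 ⊗ (1 ⊗ b) <-> exists c : k, b = c%:A.
Proof.
split=> [mub|[c ->]]; last by rewrite linearZ rmorph1 !toneE !tpureZr.
have := mu_mulr (torsorP T) b.
rewrite mub tmapE /= mul_op_lE mul1r => /esym/tpure1_scalar[_ [c bc]].
by exists c.
Qed.

Lemma Hl_galois (hl : hopf_algebra (Hl T)) :
  (forall h, tmap val val (comul hl h) = Dl (val h)) ->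
  (forall h, mul_op_r (val h) = (counit hl h)%:A) ->
  exists delta : {lrmorphism T -> (Hl T ⊗ T)%type},
    is_Hl_coaction delta /\ left_galois_extension hl delta.
Proof.
move=> comulE counitE.
have [delta deltaE] : exists delta : {lrmorphism T -> (Hl T ⊗ T)%type},
    forall x, tmap val idfun (delta x) = lcoact x.
  apply: (lrmorphism_factor (f := lcoact)).
  - exact/tmap_idr_inj/val_inj.
  - by apply: tmap_monoid; [apply: val_Hl_monoid | apply: idfun_monoid].
  - exact: lcoact_monoid.
  - by move=> x; apply: (tensor_eqr Hl_val_im); apply: lcoact_Hl.
exists delta; split; first by move=> x; rewrite deltaE /lcoact /= tassocVK.
have vinj := @val_inj _ _ (Hl T).
split.
- split=> b.
    apply: (tmap_inj vinj (tmap_idr_inj vinj)).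
    rewrite -tassoc_tmap.
    rewrite (tmap_square (h' := Dl) (h := val)
      (l' := idfun) (l := idfun) _ comulE)//.
    rewrite deltaE lcoact_coassoc -deltaE.
    by apply: tmap_square => // x; rewrite /= deltaE.
  apply: (tmap_idr_inj (@scalar_map_inj k T)).
  rewrite (tmap_square (h' := @mul_op_r k T) (h := val)
    (l' := idfun) (l := idfun))//.
    by rewrite deltaE lcoact_counit tmapE rmorph1.
  by move=> a; rewrite /= counitE.
- move=> b; rewrite -mu_coinv; split=> [db|mub].
    rewrite -[LHS](@tassocVK k T T^c T) -[tassocV _]/(lcoact b) -deltaE db.
    rewrite tmapE.
    exact: (tassocE 1 1 b).
  apply: (tmap_idr_inj vinj).
  by rewrite deltaE /lcoact /= mub tassocVE tmapE.
(* Inside [A ⊗ T] the canonical map is [a ⊗ b |-> (a1 ⊗ a2) ⊗ a3 b]. *)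
have canE x :
    tmap val idfun (left_can delta x) = tmap idfun (@tmul k T) (lcoactT x).
  tensor_elim2 x as a b.
  rewrite /left_can lcoactTE -deltaE; tensorE.
  by tensor_elim2 (delta a) as h t; tensorE.
(* [J] is [(a ⊗ b) ⊗ y |-> a ⊗ by], and its restriction to [Hl T ⊗ T] is the inverse. One composite
   is [a1 ⊗ a2 a3 b], settled by axiom (i). *)
pose J : {linear (A ⊗ T)%type -> (T ⊗ T)%type} :=
  tmap idfun (@mul_op_l k T) \o @tassoc k T T^c T.
exists (J \o tmap (val : {linear Hl T -> A}) idfun) => x /=.
  rewrite canE; tensor_elim2 x as a b; rewrite lcoactTE /lcoact /=.
  have := congr1 (tmap idfun (@tmul k T \o @tpurer k T T b))
    (mu_mulr (torsorP T) a).
  rewrite tmapE /= /tpurer tmul_pure mul1r => <-.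
  tensor_elim3 (mu a) as u v w; tensorE; rewrite /tpurer; tensorE.
  by rewrite !mul_op_lE mulrA.
(* The other composite is [(a1 ⊗ a2) ⊗ a3 b y]; the right counit law of [hl] identifies it with
   [(a ⊗ b) ⊗ y]. *)
apply: (tmap_idr_inj vinj); rewrite canE.
tensor_elim2 x as h y; rewrite tmapE /=.
have := comul_counitr hl h => /(congr1 (tmap val (@scalar_map k T))).
have counitE' h' : scalar_map T (counit hl h') = mul_op_r (val h').
  by rewrite counitE.
rewrite (tmap_square (h' := idfun) (h := val)
  (l' := @mul_op_r k T) (l := val) _ _ counitE')//.
rewrite comulE tmapE rmorph1.
move=> /(congr1 (tmap idfun (@tmul k T \o @tpurer k T T y))).
rewrite tmapE /= /tpurer tmul_pure mul1r => hE; rewrite -[RHS]hE {hE}.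
tensor_elim2 (val h) as a b; tensorE; rewrite mul_op_lE !lcoactTE.
rewrite /lcoact /=; tensor_elim3 (mu a) as u v w; tensorE.
by rewrite /tpurer; tensorE; rewrite mul_op_rE mulrA.
Qed.

End LeftHopf.

(** * The Hopf algebra H_r(T) *)

Section RightHopf.
Variables (k : fieldType) (T : torsor k).
Local Notation mu := (mu T).
Local Notation theta := (theta T).
Local Notation mu_op := (mu_op mu).
Local Notation A := (T^c ⊗ T)%type.

Definition Hr_lhs : A -> (T^c ⊗ (T ⊗ (T^c ⊗ T)))%type :=
  tmap idfun (tmap theta idfun) \o tmap idfun mu.
HB.instance Definition _ := GRing.Linear.on Hr_lhs.
Definition Hr_rhs : A -> (T^c ⊗ (T ⊗ (T^c ⊗ T)))%type :=
  @tassoc3 _ _ _ _ _ \o tmap mu_op idfun.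
HB.instance Definition _ := GRing.Linear.on Hr_rhs.

Lemma in_HrE x : in_Hr x <-> Hr_lhs x = Hr_rhs x.
Proof. by split=> /eqP. Qed.

Lemma Hr_lhsE a b : Hr_lhs (a ⊗ b) = a ⊗ tmap theta idfun (mu b).
Proof. by rewrite /Hr_lhs /= tmapE /= tmapE. Qed.

Lemma Hr_rhsE a b : Hr_rhs (a ⊗ b) = tassoc3 (tau13 (mu (of_op T a)) ⊗ b).
Proof. by rewrite /Hr_rhs /= tmapE. Qed.

Lemma val_Hr_eq (h : Hr T) : Hr_lhs (val h) = Hr_rhs (val h).
Proof. exact/in_HrE/valP. Qed.

Lemma Hr_val_im x : Hr_lhs x = Hr_rhs x -> exists h : Hr T, val h = x.
Proof. by move=> /in_HrE xH; exists (MkHr xH). Qed.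

(* [y ⊗ a |-> (y ⊗ a1) ⊗ (a2 ⊗ a3)]; for [Y = T^c] this is the coproduct. *)
Definition rcoactT (Y : algType k) : (Y ⊗ T)%type -> ((Y ⊗ T) ⊗ A)%type :=
  @tassocV k Y T A \o tmap idfun mu.
HB.instance Definition _ (Y : algType k) := GRing.Linear.on (@rcoactT Y).
Local Notation Dr := (@rcoactT T^c).

Lemma rcoactTE (Y : algType k) (y : Y) a :
  rcoactT (y ⊗ a) = tmap (@tpurel k Y T y) idfun (mu a).
Proof.
rewrite /rcoactT /= tmapE; tensor_elim2 (mu a) as u v.
by tensorE; rewrite /tpurel.
Qed.

(** * Coassociativity on the right and stability of the defining equation *)

Lemma rcoact_coassoc a :
  tassoc (tmap mu idfun (mu a)) = tmap idfun Dr (mu a).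
Proof.
have -> : tmap idfun Dr (mu a) = tmap idfun (@tassocV k T^c T A)
    (tmap idfun (tmap idfun mu) (mu a)).
  by rewrite tmap_comp; apply: eq_tmap.
rewrite (mu_coassoc (torsorP T)); tensor_elim3 (mu a) as u v w; tensorE.
by tensor_elim3 (mu u) as p q r; tensorE.
Qed.

Lemma rcoactT_coassoc x : tassoc (tmap Dr idfun (Dr x)) = tmap idfun Dr (Dr x).
Proof.
tensor_elim2 x as a b; rewrite rcoactTE.
have -> : tmap idfun Dr (tmap (tpurel a) idfun (mu b)) =
    tmap (tpurel a) idfun (tmap idfun Dr (mu b)) by apply: tmap_square.
have -> : tmap Dr idfun (tmap (tpurel a) idfun (mu b)) =
    tmap (tmap (tpurel a) idfun) idfun (tmap mu idfun (mu b)).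
  by apply: tmap_square => // c; rewrite /= -rcoactTE.
rewrite -rcoact_coassoc tassoc_tmap; apply: eq_tmap => // c.
by rewrite /= tmap_id.
Qed.

Lemma rcoactT_monoid : monoid_morphism Dr.
Proof.
apply: comp_monoid (tassocV_monoid _ _ _) _.
by apply: tmap_monoid; [apply: idfun_monoid | apply: lrmorphism_monoid].
Qed.

(** Here [mu] acts on the last factor, so axiom (iii) first moves it to the first factor, where
    axiom (iv) applies. *)
Lemma rcoact_Hr (x : T) : tmap idfun Hr_lhs (mu x) = tmap idfun Hr_rhs (mu x).
Proof.
transitivity (tmap idfun (tmap idfun (tmap theta idfun))
    (tmap idfun (tmap idfun mu) (mu x))).
  by rewrite tmap_comp; apply: eq_tmap.
rewrite (mu_coassoc (torsorP T)) (mu_theta3 (torsorP T)).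
exact: eq_tmap.
Qed.

Lemma rcoactT_Hr x : tmap idfun Hr_lhs (Dr x) = tmap idfun Hr_rhs (Dr x).
Proof.
tensor_elim2 x as a b; rewrite rcoactTE.
rewrite (tmap_square (h' := tpurel a) (h := idfun)
  (l' := idfun) (l := Hr_lhs))//.
by rewrite rcoact_Hr; apply: tmap_square.
Qed.

(* [p ⊗ q ⊗ r ⊗ s |-> (p ⊗ q ⊗ r ⊗ s1) ⊗ (s2 ⊗ s3)] *)
Definition rcoact4 : (T^c ⊗ (T ⊗ (T^c ⊗ T)))%type ->
    ((T^c ⊗ (T ⊗ (T^c ⊗ T))) ⊗ A)%type :=
  @tassocV k _ _ _ \o tmap idfun (@tassocV k T _ A \o tmap idfun Dr).
HB.instance Definition _ := GRing.Linear.on rcoact4.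

Lemma rcoactT_rhs x : tmap Hr_rhs idfun (Dr x) = rcoact4 (Hr_rhs x).
Proof.
tensor_elim2 x as a b; rewrite rcoactTE Hr_rhsE.
transitivity (tmap (@tassoc3 k T^c T T^c T) idfun
    (tassocV (tau13 (mu (of_op T a)) ⊗ mu b))).
  by tensor_elim2 (mu b) as u v; tensorE; rewrite /tpurel Hr_rhsE.
tensor_elim3 (tau13 (mu (of_op T a))) as p q r.
rewrite /rcoact4; tensorE; rewrite rcoactTE.
by tensor_elim2 (mu b) as u v; tensorE; rewrite /tpurel; tensorE.
Qed.

(** Coassociativity moves the coaction past the [mu] inside [Hr_lhs], whereas [Hr_rhs] leaves the
    last factor alone. *)
Lemma rcoactT_lhs x : tmap Hr_lhs idfun (Dr x) = rcoact4 (Hr_lhs x).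
Proof.
tensor_elim2 x as a b; rewrite rcoactTE Hr_lhsE.
have := congr1 (tmap (@tpurel k T^c _ a) idfun \o
  (@tassocV k T (T^c ⊗ T)%type A \o tmap theta (@tassocV k T^c T A)))
  (mu_coassoc (torsorP T) b) => /esym; congr (_ = _).
  tensor_elim3 (mu b) as u v w; tensorE; rewrite /tpurel Hr_lhsE.
  by tensor_elim3 (mu u) as p q r; tensorE; rewrite /tpurel.
tensor_elim3 (mu b) as u v w; rewrite /rcoact4; tensorE; rewrite rcoactTE.
by tensor_elim2 (mu w) as p q; tensorE; rewrite /tpurel; tensorE.
Qed.

Lemma rcoactT_idr_Hr x : Hr_lhs x = Hr_rhs x ->
  tmap Hr_lhs idfun (Dr x) = tmap Hr_rhs idfun (Dr x).
Proof. by move=> xH; rewrite rcoactT_lhs rcoactT_rhs xH. Qed.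

(** * The counit of H_r(T) *)

Definition mul_theta_r : A -> T := @mul_rev_r k T \o tmap idfun theta.
HB.instance Definition _ := GRing.Linear.on mul_theta_r.

Lemma mul_theta_rE a b : mul_theta_r (a ⊗ b) = theta b * of_op T a.
Proof. by rewrite /mul_theta_r /= tmapE mul_rev_rE. Qed.

Lemma rcoactT_counitr x : tmap idfun (@mul_op_l k T) (Dr x) = x ⊗ 1.
Proof.
tensor_elim2 x as a b; rewrite rcoactTE.
rewrite (tmap_square (h' := tpurel a) (h := idfun)
  (l' := idfun) (l := @mul_op_l k T))//.
by rewrite (mu_mulr (torsorP T)) tmapE.
Qed.

(** Multiplying the first two factors of the equation in reverse order gives
    [(theta b1) a ⊗ b2 ⊗ b3] on the left and [a2 a3 ⊗ a1 ⊗ b] on the right, which axiom (i)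
    collapses. *)
Lemma rcoactT_counitl x : Hr_lhs x = Hr_rhs x ->
  tmap mul_theta_r idfun (Dr x) = 1 ⊗ x.
Proof.
move=> /(congr1 (tmap (@mul_rev_r k T) idfun \o @tassocV k T^c T A)).
congr (_ = _).
  tensor_elim2 x as a b; rewrite Hr_lhsE rcoactTE.
  tensor_elim2 (mu b) as p q; tensorE.
  by rewrite /tpurel mul_theta_rE mul_rev_rE.
tensor_elim2 x as a b; rewrite Hr_rhsE.
have := congr1 (tmap idfun (@tpurer k T^c T b \o to_op T) \o @tswap k T T)
  (mu_mulr (torsorP T) (of_op T a)).
rewrite /= tswapE tmapE => <-.
tensor_elim3 (mu (of_op T a)) as p q r; tensorE.
by rewrite mul_rev_rE mul_op_lE.
Qed.

Lemma mul_op_l_Hr x : Hr_lhs x = Hr_rhs x ->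
  mul_theta_r x = mul_op_l x /\ exists c : k, mul_theta_r x = c%:A.
Proof.
move=> xH; apply: tpure1_scalar.
have := congr1 (tmap idfun (@mul_op_l k T)) (rcoactT_counitl xH).
rewrite tmapE => <-.
rewrite (tmap_square (h' := mul_theta_r) (h := idfun)
  (l' := idfun) (l := @mul_op_l k T))//.
by rewrite rcoactT_counitr tmapE.
Qed.

Lemma mul_op_lM x y c :
  mul_op_l x = c%:A -> mul_op_l (x * y) = c *: mul_op_l y :> T.
Proof.
move=> xc; elim/tensor_ind: y => [|a b y IH].
  by rewrite mulr0 !linear0.
rewrite mulrDr !linearD /= IH ?scalerDr; congr (_ + _).
have -> : mul_op_l (x * (a ⊗ b)) = of_op T a * mul_op_l x * b.
  elim/tensor_ind: x {xc IH} => [|u v x IH].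
    by rewrite mul0r !linear0 mulr0 mul0r.
  rewrite mulrDl !linearD /= IH mulrDr mulrDl tmulE !mul_op_lE.
  by rewrite of_opM !mulrA.
by rewrite xc mul_op_lE -scalerAr mulr1 -scalerAl.
Qed.

(** * The antipode of H_r(T) *)

Definition antipode_r : A -> A :=
  tmap (to_op T \o theta) (of_op T) \o @tswap k T^c T.
HB.instance Definition _ := GRing.Linear.on antipode_r.

Lemma antipode_rE a b : antipode_r (a ⊗ b) = to_op T (theta b) ⊗ of_op T a.
Proof. by rewrite /antipode_r; tensorE. Qed.

Lemma antipode_r_convr x :
  tmul (tmap idfun antipode_r (Dr x)) = to_op T (mul_theta_r x) ⊗ 1.
Proof.
tensor_elim2 x as a b; rewrite rcoactTE.
have := congr1 (tmap
  (to_op T \o (@tmul k T \o @tpurer k T T (of_op T a)) \o theta) idfun \o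
  @tswap k _ _) (mu_mull (torsorP T) b).
rewrite /= tswapE tmapE /= /tpurer tmul_pure mul_theta_rE => <-.
tensor_elim3 (mu b) as p q r; tensorE; rewrite /tpurel /tpurer antipode_rE.
by rewrite tmulE mul_op_rE; tensorE.
Qed.

(** The defining equation turns the convolution [b2 (theta b1) ⊗ a b3] into [a1 a2 ⊗ a3 b], and
    axiom (ii) gives [1 ⊗ ab]. *)
Lemma antipode_r_convl x : Hr_lhs x = Hr_rhs x ->
  tmul (tmap antipode_r idfun (Dr x)) = 1 ⊗ mul_op_l x.
Proof.
(* [F] is [p ⊗ q ⊗ r ⊗ s |-> r q ⊗ p s]. *)
pose F : {linear (T^c ⊗ (T ⊗ (T^c ⊗ T)))%type -> A} :=
  tmap (to_op T \o @mul_rev_l k T) (@mul_op_l k T) \o @tassoc k _ _ _ \o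
  tmap (@tswap k _ _) idfun \o @tassocV k T^c (T ⊗ T^c)%type T \o
  tmap idfun (@tassocV k T T^c T).
move=> /(congr1 F); congr (_ = _).
  tensor_elim2 x as a b; rewrite Hr_lhsE rcoactTE.
  tensor_elim3 (mu b) as p q r; tensorE; rewrite /tpurel antipode_rE.
  by rewrite mul_op_lE mul_rev_lE; tensorE.
tensor_elim2 x as a b; rewrite Hr_rhsE mul_op_lE.
have := congr1 (tmap (to_op T) (@tmul k T \o @tpurer k T T b))
  (mu_mull (torsorP T) (of_op T a)).
rewrite tmapE /= /tpurer tmul_pure => <-.
tensor_elim3 (mu (of_op T a)) as p q r; tensorE.
by rewrite mul_op_lE mul_op_rE mul_rev_lE.
Qed.

Lemma antipode_r_Hr x : Hr_lhs x = Hr_rhs x ->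
  Hr_lhs (antipode_r x) = Hr_rhs (antipode_r x).
Proof.
(* [P] is [p ⊗ q ⊗ r ⊗ s |-> theta s ⊗ theta r ⊗ q ⊗ p]. *)
pose P : {linear (T^c ⊗ (T ⊗ (T^c ⊗ T)))%type ->
    (T^c ⊗ (T ⊗ (T^c ⊗ T)))%type} :=
  tmap (to_op T \o theta) (tmap (of_op T \o theta_op theta)
    (tmap (to_op T) (of_op T))) \o @tflip14 k _ _ _ _.
move=> /(congr1 P)/esym; congr (_ = _).
  tensor_elim2 x as a b; rewrite Hr_rhsE antipode_rE Hr_lhsE.
  by tensor_elim3 (mu (of_op T a)) as p q r; tensorE; rewrite tflip14E; tensorE.
tensor_elim2 x as a b; rewrite Hr_lhsE antipode_rE Hr_rhsE.
rewrite -(mu_theta (torsorP T)).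
by tensor_elim3 (mu b) as p q r; tensorE; rewrite tflip14E; tensorE.
Qed.

Lemma val_Hr_monoid : monoid_morphism (val : Hr T -> A).
Proof. by split; [apply: rmorph1 | apply: rmorphM]. Qed.

Lemma Hr_hopf : exists hr : hopf_algebra (Hr T),
  (forall h, tmap val val (comul hr h) = Dr (val h)) /\
  (forall h, mul_op_l (val h) = (counit hr h)%:A).
Proof.
have theta_mul (h : Hr T) : mul_op_l (val h) = mul_theta_r (val h).
  by case: (mul_op_l_Hr (val_Hr_eq h)).
have scalar (h : Hr T) : exists c : k, mul_op_l (val h) = c%:A.
  by rewrite theta_mul; case: (mul_op_l_Hr (val_Hr_eq h)).
(* The left counit law is available for [mul_theta_r], which therefore serves as [el]; the counit is
   rewritten through [mul_op_l] at the end. *)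
have [hr [comulE counitE]] : exists hr : hopf_algebra (Hr T),
    (forall h, tmap val val (comul hr h) = Dr (val h)) /\
    (forall h, mul_theta_r (val h) = (counit hr h)%:A).
  apply: (@hopf_subalgebra k (Hr T) A _ T val Hr_lhs Hr_rhs Dr mul_theta_r
    (@mul_op_l k T) antipode_r).
  - exact: val_Hr_monoid.
  - exact: val_inj.
  - exact: Hr_val_im.
  - exact: rcoactT_monoid.
  - exact: rcoactT_coassoc.
  - by move=> h; apply/rcoactT_idr_Hr/val_Hr_eq.
  - by move=> h; apply: rcoactT_Hr.
  - by rewrite /= toneE mul_theta_rE /= mulr1 rmorph1.
  - move=> h h' /=.
    rewrite -!theta_mul -[val h * val h']/(val (h * h')) -theta_mul.
    have [c cE] := scalar h.
    by rewrite /= (mul_op_lM _ cE) cE -scalerAl mul1r.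
  - by move=> h; rewrite /= -theta_mul.
  - by move=> h; rewrite /= -theta_mul.
  - by move=> h; apply/rcoactT_counitl/val_Hr_eq.
  - by move=> h; apply: rcoactT_counitr.
  - by move=> h; apply/Hr_val_im/antipode_r_Hr/val_Hr_eq.
  - move=> h c hc; rewrite /= antipode_r_convl; last exact: val_Hr_eq.
    by rewrite theta_mul hc tpureZr.
  - by move=> h c hc; rewrite /= antipode_r_convr hc linearZ tpureZl.
by exists hr; split=> // h; rewrite theta_mul.
Qed.

(** * Coinvariants and the right Galois property *)

Lemma mu_coinvr (b : T) : mu b = b ⊗ 1 <-> exists c : k, b = c%:A.
Proof.
split=> [mub|[c ->]]; last by rewrite linearZ rmorph1 !toneE tpureZl.
have := mu_mull (torsorP T) b.
rewrite mub toneE tassocVE tmapE /= mul_op_rE mulr1.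
by move=> /tpure1_scalar[_].
Qed.

Lemma Hr_galois (hr : hopf_algebra (Hr T)) :
  (forall h, tmap val val (comul hr h) = Dr (val h)) ->
  (forall h, mul_op_l (val h) = (counit hr h)%:A) ->
  exists delta : {lrmorphism T -> (T ⊗ Hr T)%type},
    is_Hr_coaction delta /\ right_galois_extension hr delta.
Proof.
move=> comulE counitE.
have [delta deltaE] : exists delta : {lrmorphism T -> (T ⊗ Hr T)%type},
    forall x, tmap idfun val (delta x) = mu x.
  apply: (lrmorphism_factor (f := mu)).
  - exact/tmap_idl_inj/val_inj.
  - by apply: tmap_monoid; [apply: idfun_monoid | apply: val_Hr_monoid].
  - exact: lrmorphism_monoid.
  - by move=> x; apply: (tensor_eql Hr_val_im); apply: rcoact_Hr.
exists delta; split; first exact: deltaE.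
have vinj := @val_inj _ _ (Hr T).
split.
- split=> b.
    apply: (tmap_idl_inj (tmap_inj vinj vinj)); rewrite -tassoc_tmap.
    rewrite (tmap_square (h' := mu) (h := idfun)
      (l' := idfun) (l := val) _ deltaE)//.
    rewrite deltaE rcoact_coassoc -deltaE.
    by apply: tmap_square => // x; rewrite /= comulE.
  apply: (tmap_idl_inj (@scalar_map_inj k T)).
  rewrite (tmap_square (h' := idfun) (h := idfun)
    (l' := @mul_op_l k T) (l := val))//.
    by rewrite deltaE (mu_mulr (torsorP T)) tmapE rmorph1.
  by move=> a; rewrite /= counitE.
- move=> b; rewrite -mu_coinvr; split=> [db|mub].
    by rewrite -deltaE db tmapE.
  by apply: (tmap_idl_inj vinj); rewrite deltaE mub tmapE.
have canE x :
    tmap idfun val (right_can delta x) = tmap (@tmul k T) idfun (rcoactT x).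
  tensor_elim2 x as a b.
  rewrite /right_can rcoactTE -deltaE; tensorE.
  by tensor_elim2 (delta b) as t h; tensorE.
(* [J] is [y ⊗ (a ⊗ b) |-> ya ⊗ b]. One composite is [a b1 b2 ⊗ b3], settled by axiom (ii); the
   other is [y a b1 ⊗ (b2 ⊗ b3)], settled by the left counit law of [hr]. *)
pose J : {linear (T ⊗ A)%type -> (T ⊗ T)%type} :=
  tmap (@mul_op_r k T) idfun \o @tassocV k T T^c T.
exists (J \o tmap idfun (val : {linear Hr T -> A})) => x /=.
  rewrite canE; tensor_elim2 x as a b; rewrite rcoactTE.
  have := congr1 (tmap (lmul a) idfun) (mu_mull (torsorP T) b).
  rewrite tmapE /= /lmul mulr1 => <-.
  tensor_elim3 (mu b) as u v w; tensorE; rewrite /tpurel; tensorE.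
  by rewrite !mul_op_rE /lmul mulrA.
apply: (tmap_idl_inj vinj); rewrite canE.
tensor_elim2 x as y h; rewrite tmapE /=.
have := comul_counitl hr h => /(congr1 (tmap (@scalar_map k T) val)).
have counitE' h' : scalar_map T (counit hr h') = mul_op_l (val h').
  by rewrite counitE.
rewrite (tmap_square (h' := @mul_op_l k T) (h := val)
  (l' := idfun) (l := val) _ counitE')//.
rewrite comulE tmapE rmorph1 => /(congr1 (tmap (lmul y) idfun)).
rewrite tmapE /= /lmul mulr1 => hE; rewrite -[RHS]hE.
tensor_elim2 (val h) as a b; tensorE; rewrite mul_op_rE !rcoactTE.
tensor_elim3 (mu b) as u v w; tensorE; rewrite /tpurel; tensorE.
by rewrite mul_op_lE /lmul mulrA.
Qed.

End RightHopf.

(** * Dimensions *)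

Section Dimension.
Variable k : fieldType.

Lemma has_dimP (V : lmodType k) n : has_dim V n <->
  exists (r : {linear V -> 'rV[k]_n}) (r' : {linear 'rV[k]_n -> V}),
    cancel r r' /\ cancel r' r.
Proof.
split=> [[[r rlin [r' rK r'K]]]|[r [r' [rK r'K]]]]; last first.
  by split; exists r; [exact: linearP | exists r'].
have r'lin : linear r'.
  by move=> a x y; apply: (can_inj rK); rewrite r'K rlin !r'K.
pose rM := GRing.isLinear.Build k V 'rV[k]_n _ r rlin.
pose r'M := GRing.isLinear.Build k 'rV[k]_n V _ r' r'lin.
exists (HB.pack_for {linear V -> 'rV[k]_n} r rM).
by exists (HB.pack_for {linear 'rV[k]_n -> V} r' r'M).
Qed.

Lemma has_dim_bij (V W : lmodType k) (f : {linear V -> W}) n :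
  bijective f -> has_dim V n -> has_dim W n.
Proof.
move=> [g fK gK] [[r rlin [r' rK r'K]]].
have glin : linear g by move=> a x y; apply: (can_inj fK); rewrite linearP !gK.
split; exists (r \o g); first by move=> a x y; rewrite /= glin rlin.
by exists (f \o r') => x /=; rewrite ?rK ?gK ?fK ?r'K.
Qed.

Lemma rV_inj_leq m n (f : {linear 'rV[k]_m -> 'rV[k]_n}) :
  injective f -> (m <= n)%N.
Proof.
move=> finj; have : row_free (lin1_mx f).
  apply/inj_row_free => v; rewrite mul_rV_lin1 => fv0.
  by apply: finj; rewrite fv0 linear0.
by rewrite -row_leq_rank => /leq_trans; apply; apply: rank_leq_col.
Qed.

Lemma has_dim_uniq (V : lmodType k) m n : has_dim V m -> has_dim V n -> m = n.
Proof.
suff le a b : has_dim V a -> has_dim V b -> (a <= b)%N.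
  by move=> Vm Vn; apply/eqP; rewrite eqn_leq !le.
move=> /has_dimP[r [r' [_ r'K]]] /has_dimP[s [s' [sK _]]].
apply: (@rV_inj_leq _ _ (s \o r')).
exact: inj_comp (can_inj sK) (can_inj r'K).
Qed.

(* The coordinates of [W] turn [i \o p] into an idempotent matrix, whose row
   space is a copy of [V]. *)
Lemma has_dim_retract (V W : lmodType k) (i : {linear V -> W})
    (p : {linear W -> V}) n :
  cancel i p -> has_dim W n -> exists m, has_dim V m.
Proof.
move=> iK /has_dimP[r [r' [rK r'K]]].
pose E := lin1_mx (r \o i \o p \o r').
have EE v : v *m E = r (i (p (r' v))) by rewrite mul_rV_lin1.
have sub v : (r (i v) <= row_base E)%MS.
  by rewrite eq_row_base (_ : r (i v) = r (i v) *m E) ?submxMl// EE rK iK.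
(* The coordinates of [v] are those of the row [r (i v)] in the basis [row_base E], read off by
   [pinvmx]. *)
exists (\rank E); split; exists (fun v => r (i v) *m pinvmx (row_base E)).
  by move=> a u v; rewrite !linearP mulmxDl -scalemxAl.
exists (fun w => p (r' (w *m row_base E))) => [v|w].
  by rewrite mulmxKpV// rK iK.
rewrite -EE.
have /submxP[D wD] : (w *m row_base E <= E)%MS.
  by rewrite (submx_trans (submxMl _ _)) ?eq_row_base.
have -> : w *m row_base E *m E = w *m row_base E.
  by rewrite wD !EE rK iK.
by rewrite mulmxKp// row_base_free.
Qed.

Lemma tpure_sumr (U V : algType k) I (s : seq I) (u : U) (v : I -> V) :
  u ⊗ (\sum_(i <- s) v i) = \sum_(i <- s) u ⊗ v i.
Proof. exact: (linear_sum (@tpurel k U V u)). Qed.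

Lemma tpure_suml (U V : algType k) I (s : seq I) (u : I -> U) (v : V) :
  (\sum_(i <- s) u i) ⊗ v = \sum_(i <- s) u i ⊗ v.
Proof. exact: (linear_sum (@tpurer k U V v)). Qed.

(** A pure tensor gets the flattened outer product of the coordinates of its factors, so tensors of
    basis vectors go to matrix units. *)
Definition kronecker (U V : algType k) m n (r : U -> 'rV[k]_m)
    (s : V -> 'rV[k]_n) : (U ⊗ V)%type -> 'rV[k]_(m * n) :=
  tlift (fun u v => mxvec ((r u)^T *m s v)).

Section Kronecker.
Variables (U V : algType k) (m n : nat).
Variables (r : {linear U -> 'rV[k]_m}) (s : {linear V -> 'rV[k]_n}).

Fact kronecker_bilinear : bilinear_fun (fun u v => mxvec ((r u)^T *m s v)).
Proof.
split=> [v|u] a x y /=.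
  by rewrite linearP linearD linearZ mulmxDl -scalemxAl linearP.
by rewrite linearP mulmxDr -scalemxAr linearP.
Qed.

HB.instance Definition _ := GRing.isLinear.Build k _ _ _ (kronecker r s)
  (tlift_linear kronecker_bilinear).

Lemma kroneckerE u v : kronecker r s (u ⊗ v) = mxvec ((r u)^T *m s v).
Proof. exact: (tlift_pure kronecker_bilinear). Qed.

End Kronecker.

Lemma rV_sum_delta (W : lmodType k) n (f : {linear 'rV[k]_n -> W}) w :
  f w = \sum_i w 0 i *: f (delta_mx 0 i).
Proof.
rewrite {1}[w]row_sum_delta linear_sum.
by apply: eq_bigr => i _; rewrite linearZ.
Qed.

Lemma tensor_has_dim (U V : algType k) m n :
  has_dim U m -> has_dim V n -> has_dim (U ⊗ V)%type (m * n).
Proof.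
move=> /has_dimP[r [r' [rK r'K]]] /has_dimP[s [s' [sK s'K]]].
pose g (w : 'rV[k]_(m * n)) : (U ⊗ V)%type :=
  \sum_i \sum_j vec_mx w i j *: (r' (delta_mx 0 i) ⊗ s' (delta_mx 0 j)).
have glin : linear g.
  move=> a x y; rewrite /g scaler_sumr -big_split; apply: eq_bigr => i _ /=.
  rewrite scaler_sumr -big_split; apply: eq_bigr => j _ /=.
  by rewrite linearP /= !mxE scalerDl scalerA.
have gK : cancel (kronecker r s) g.
  pose gM := GRing.isLinear.Build k 'rV[k]_(m * n) (U ⊗ V)%type _ g glin.
  pose gL := HB.pack_for {linear 'rV[k]_(m * n) -> (U ⊗ V)%type} g gM.
  apply: (tensor_linear_eq (f := gL \o kronecker r s) (g := idfun)) => u v /=.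
  rewrite kroneckerE /g mxvecK -[in RHS](rK u) -[in RHS](sK v).
  rewrite [r' _]rV_sum_delta [s' _]rV_sum_delta tpure_suml.
  apply: eq_bigr => i _; rewrite tpure_sumr; apply: eq_bigr => j _.
  by rewrite tpureZl tpureZr scalerA !mxE big_ord1 !mxE.
split; exists (kronecker r s); first exact: linearP.
exists g => // w; apply: (can_inj (@vec_mxK _ _ _)).
rewrite [RHS]matrix_sum_delta /g (linear_sum (kronecker r s)) linear_sum.
apply: eq_bigr => i _ /=; rewrite (linear_sum (kronecker r s)) linear_sum.
apply: eq_bigr => j _ /=.
rewrite !linearZ /= kroneckerE r'K s'K mxvecK.
by rewrite trmx_delta mul_delta_mx.
Qed.

End Dimension.

(** * Dimension count for Galois extensions *)

Section GaloisDimension.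
Variable k : fieldType.

Lemma has_dim_gt0 (B : algType k) n : has_dim B n -> (0 < n)%N.
Proof.
move=> [[r _ [r' rK _]]]; case: n r r' rK => // r r' rK.
by have /eqP := oner_neq0 B; case; apply: (can_inj rK); rewrite !thinmx0.
Qed.

(** Finite dimension of [H] has to be proved first: [h |-> h ⊗ 1] is split by a functional with
    value 1 at 1, so [H] is a retract of [H ⊗ B]. Then [m * n = n * n] is cancelled, as [1 != 0] in
    [B] forces [n > 0]. *)
Lemma has_dim_tensor_cancel (H B : algType k) n :
  has_dim B n -> has_dim (H ⊗ B)%type (n * n) -> has_dim H n.
Proof.
move=> Bn HBn; have [f f1] := exists_functional (oner_neq0 B).
have [] := @has_dim_retract k H (H ⊗ B)%type (@tpurer k H B 1)
  (tcontract f \o @tswap k H B) _ _ HBn.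
  by move=> h; rewrite /= /tpurer tswapE tcontractE f1 scale1r.
move=> m Hm; have /eqP := has_dim_uniq (tensor_has_dim Hm Bn) HBn.
by rewrite eqn_pmul2r ?(has_dim_gt0 Bn)// => /eqP <-.
Qed.

Lemma left_galois_has_dim (H B : algType k) (hH : hopf_algebra H)
    (delta : {lrmorphism B -> (H ⊗ B)%type}) n :
  left_galois_extension hH delta -> has_dim B n -> has_dim H n.
Proof.
move=> [_ _ can_bij] Bn; apply: (has_dim_tensor_cancel Bn).
exact: has_dim_bij can_bij (tensor_has_dim Bn Bn).
Qed.

Lemma right_galois_has_dim (H B : algType k) (hH : hopf_algebra H)
    (delta : {lrmorphism B -> (B ⊗ H)%type}) n :
  right_galois_extension hH delta -> has_dim B n -> has_dim H n.
Proof.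
move=> [_ _ can_bij] Bn; apply: (has_dim_tensor_cancel Bn).
have swap_bij : bijective (@tswap k B H).
  by exists (@tswap k H B); apply: tswapK.
apply: has_dim_bij swap_bij _.
exact: has_dim_bij can_bij (tensor_has_dim Bn Bn).
Qed.

End GaloisDimension.

Local Close Scope ring_scope.

Theorem proposition3p1 (k : fieldType) (T : torsor k) :
  [/\ exists (hl : hopf_algebra (Hl T)) (delta : {lrmorphism T -> Hl T ⊗ T}),
        [/\ is_Hl_hopf hl, is_Hl_coaction delta
          & left_galois_extension hl delta],
      exists (hr : hopf_algebra (Hr T)) (delta : {lrmorphism T -> T ⊗ Hr T}),
        [/\ is_Hr_hopf hr, is_Hr_coaction delta
          & right_galois_extension hr delta]
    & forall n : nat, has_dim T n -> has_dim (Hl T) n /\ has_dim (Hr T) n].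
Proof.
have [hl [comull counitl]] := Hl_hopf T.
have [hr [comulr counitr]] := Hr_hopf T.
have [dl [dlE dlG]] := Hl_galois comull counitl.
have [dr [drE drG]] := Hr_galois comulr counitr.
split.
- exists hl, dl; split=> //; split=> h //.
  (* The coproduct is known in [A ⊗ A]; reassociating gives the form in the fourfold tensor
     product. *)
  by rewrite comull lcoactT_mu_id.
- exists hr, dr; split=> //; split=> h //.
  by rewrite comulr /rcoactT /= tassocVK.
- move=> n Tn; split; first exact: left_galois_has_dim dlG Tn.
  exact: right_galois_has_dim drG Tn.
Qed.
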